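(* The ordinary generating series $F(\mathbf{u})=\sum_{\operatorname{wt}(\mathbf{k})=-1}F_{\mathbf{k}}\,\mathbf{u}^{\mathbf{k}}$ satisfies the equivalent identities \begin{align*} F(\mathbf{u})&=\sum_{a\in A}\sum_{j\ge -1}u_{a,j}\,H_{j+1}(\mathbf{u}),\\ F(\mathbf{u})&=\sum_{a\in A}\sum_{j\ge -1}u_{a,j}\,[z^{j+1}]\prod_{\boldsymbol\ell\in\mathcal{K}_{-1}}(1-z\mathbf{u}^{\boldsymbol\ell})^{-F_{\boldsymbol\ell}},\\ F(\mathbf{u})&=\sum_{a\in A}\sum_{j\ge -1}u_{a,j}\,Z_{\mathrm{SET}_{j+1}}\big(F(\mathbf{u}^{[1]}),F(\mathbf{u}^{[2]}),\dots,F(\mathbf{u}^{[j+1]})\big). \end{align*}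
   Context: $A$ is a finite set (of decorations) and $I_A:=A\times\mathbb{Z}_{\ge -1}$. A multi-index is a finitely supported map $\mathbf{k}:I_A\to\mathbb{Z}_{\ge 0}$, written $k_j^a:=\mathbf{k}(a,j)$; set $|\mathbf{k}|=\sum_{a,j}k_j^a$ and $\operatorname{wt}(\mathbf{k})=\sum_{a,j}j\,k_j^a$ (sums over $a\in A$, $j\ge -1$). An $A$-decorated rooted tree is a finite rooted tree $t$ with a map $d:V(t)\to A$; isomorphisms preserve the root and the decorations. The fertility $f(v)$ of a vertex $v$ is its number of children. The profile of $t$ is the multi-index $\mathbf{k}(t)$ with $k_j^a(t)=\#\{v\in V(t): d(v)=a,\ f(v)=j+1\}$. Let $\mathcal{F}_{\mathbf{k}}$ be the (finite) set of isomorphism classes of $A$-decorated rooted trees with profile $\mathbf{k}$, and $F_{\mathbf{k}}:=|\mathcal{F}_{\mathbf{k}}|$. $\mathbf{u}=(u_{a,j})_{a\in A,\,j\ge -1}$ is a family of commuting variables, $\mathbf{u}^{\mathbf{k}}:=\prod_{a,j}u_{a,j}^{k_j^a}$, and $\mathbf{u}^{[r]}:=(u_{a,j}^r)_{a\in A,\,j\ge -1}$ for $r\ge 1$. All series are formal power series (over a field of characteristic zero) and all identities, infinite sums and infinite products are understood coefficientwise; $[z^m]$ extracts the coefficient of $z^m$. Let $\mathcal{K}_{-1}$ be the set of all multi-indices $\boldsymbol\ell$ with $\operatorname{wt}(\boldsymbol\ell)=-1$. For a finitely supported family $\nu=(\nu_{\boldsymbol\ell})_{\boldsymbol\ell\in\mathcal{K}_{-1}}$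 of nonnegative integers, put $|\nu|:=\sum_{\boldsymbol\ell}\nu_{\boldsymbol\ell}$ and $\Sigma(\nu):=\sum_{\boldsymbol\ell}\nu_{\boldsymbol\ell}\,\boldsymbol\ell$. For $r,m\in\mathbb{Z}_{\ge 0}$, $\operatorname{Mlt}(r,m):=[z^m](1-z)^{-r}$. For $m\ge 0$, $$H_m(\mathbf{u}):=\sum_{\substack{\nu\ \text{finitely supported on }\mathcal{K}_{-1}\\ |\nu|=m}}\Big(\prod_{\boldsymbol\ell\in\mathcal{K}_{-1}}\operatorname{Mlt}(F_{\boldsymbol\ell},\nu_{\boldsymbol\ell})\Big)\mathbf{u}^{\Sigma(\nu)}.$$ The cycle-index polynomial of $\mathrm{SET}_m$ ($m\ge 0$) is $$Z_{\mathrm{SET}_m}(p_1,\dots,p_m):=\sum_{\lambda\vdash m}\frac{p_\lambda}{z_\lambda},\qquad p_\lambda:=\prod_{r\ge 1}p_r^{m_r},\quad z_\lambda:=\prod_{r\ge 1}r^{m_r}m_r!,$$ where $m_r$ is the number of parts of the partition $\lambda$ equal to $r$ (so $Z_{\mathrm{SET}_0}=1$). *)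

(* Defs.v *)
From HB Require Import structures.
From mathcomp Require Import all_boot all_order all_algebra finmap.
From mathcomp Require Import boolp classical_sets functions cardinality fsbigop.

Set Implicit Arguments.
Unset Strict Implicit.
Unset Printing Implicit Defensive.

Import Order.TTheory GRing.Theory Num.Theory.

Local Open Scope classical_set_scope.
Local Open Scope ring_scope.

Definition mindex (I : choiceType) := {fsfun I -> nat with 0%N}.

Section MultiIndex.
Variable I : choiceType.
Implicit Types k l : mindex I.

HB.instance Definition _ := Choice.on (mindex I).

Definition mzero : mindex I := [fsfun].

Definition madd k l : mindex I :=
  [fsfun i in (finsupp k `|` finsupp l)%fset => (k i + l i)%N].

Lemma mzeroE i : mzero i = 0%N.
Proof. by rewrite /mzero fsfunE. Qed.

Lemma maddE k l i : madd k l i = (k i + l i)%N.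
Proof.
rewrite /madd fsfunE inE; case: ifPn => //.
by rewrite negb_or => /andP[? ?]; rewrite !fsfun_dflt.
Qed.

Lemma maddA : associative madd.
Proof. by move=> a b c; apply/fsfunP => i; rewrite !maddE addnA. Qed.

Lemma maddC : commutative madd.
Proof. by move=> a b; apply/fsfunP => i; rewrite !maddE addnC. Qed.

Lemma madd0 : left_id mzero madd.
Proof. by move=> a; apply/fsfunP => i; rewrite maddE mzeroE. Qed.

HB.instance Definition _ :=
  GRing.isNmodule.Build (mindex I) maddA maddC madd0.

Lemma mindexP k l : (forall i, k i = l i) <-> k = l.
Proof. exact: fsfunP. Qed.

Lemma mindex0E i : (0 : mindex I) i = 0%N.
Proof. exact: mzeroE. Qed.

Lemma mindexDE k l i : (k + l) i = (k i + l i)%N.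
Proof. exact: maddE. Qed.

Lemma mindexI k : injective (+%R k).
Proof.
move=> a b /mindexP e; apply/mindexP => i.
by have := e i; rewrite !mindexDE => /addnI.
Qed.

Definition munit (i : I) : mindex I := [fsfun mzero with i |-> 1%N].

Definition msize k : nat := (\sum_(i <- finsupp k) k i)%N.

Definition splittings k : set (mindex I * mindex I) := [set p | p.1 + p.2 = k].

Lemma finite_splittings k : finite_set (splittings k).
Proof.
pose N := (\max_(x : finsupp k) k (val x)).+1.
pose g (f : {ffun finsupp k -> 'I_N}) : mindex I * mindex I :=
  ([fsfun x : finsupp k => nat_of_ord (f x)],
   [fsfun x : finsupp k => (k (val x) - f x)%N]).
apply: (@sub_finite_set _ _ (range g)); last first.
  exact/finite_image/finite_finset.
move=> [a b] /= abk; rewrite /splittings/= in abk.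
have kE i : k i = (a i + b i)%N by rewrite -abk mindexDE.
have lt (x : finsupp k) : (a (val x) < N)%N.
  rewrite ltnS (@leq_trans (k (val x))) ?kE ?leq_addr// -kE.
  exact: (@leq_bigmax _ (fun x : finsupp k => k (val x))).
exists [ffun x => Ordinal (lt x)] => //; rewrite /g; congr pair.
- apply/mindexP => i; rewrite fsfun_ffun; case: insubP => [u _ <-|] /=.
    by rewrite ffunE.
  by rewrite mem_finsupp negbK kE addn_eq0 => /andP[/eqP->].
- apply/mindexP => i; rewrite fsfun_ffun; case: insubP => [u _ <-|] /=.
    by rewrite ffunE/= kE addKn.
  by rewrite mem_finsupp negbK kE addn_eq0 => /andP[_ /eqP->].
Qed.

End MultiIndex.

Definition fps (I : choiceType) (R : Type) := mindex I -> R.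

Section PowerSeries.
Variables (I : choiceType) (R : comNzRingType).
Implicit Types (k l : mindex I) (f g h : fps I R).

HB.instance Definition _ := GRing.Zmodule.copy (fps I R) (mindex I -> R).

Lemma fpsP f g : (forall k, f k = g k) <-> f = g.
Proof. by split=> [?|->//]; apply/funext. Qed.

Lemma fpsDE f g k : (f + g) k = f k + g k. Proof. by []. Qed.
Lemma fpsNE f k : (- f) k = - f k. Proof. by []. Qed.
Lemma fps0E k : (0 : fps I R) k = 0. Proof. by []. Qed.

Definition fps_one : fps I R := fun k => (k == 0)%:R.

Definition fps_mul f g : fps I R :=
  fun k => \sum_(p \in splittings k) f p.1 * g p.2.

Let sp k : seq (mindex I * mindex I) := fset_set (splittings k).

Let spP k p : p \in sp k = (p.1 + p.2 == k).
Proof.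
rewrite in_fset_set; last exact: finite_splittings.
by apply/idP/eqP; rewrite inE.
Qed.

Let mulE f g k : fps_mul f g k = \sum_(p <- sp k) f p.1 * g p.2.
Proof. by rewrite /fps_mul fsbig_finite//; exact: finite_splittings. Qed.

Lemma fps_mulA : associative fps_mul.
Proof.
move=> f g h; apply/fpsP => k; rewrite !mulE.
transitivity (\sum_(p <- sp k) \sum_(q <- sp p.2) f p.1 * (g q.1 * h q.2)).
  by apply: eq_bigr => p _; rewrite mulE mulr_sumr.
transitivity (\sum_(p <- sp k) \sum_(q <- sp p.1) f q.1 * (g q.2 * h p.2));
  last first.
  apply: eq_bigr => p _; rewrite mulE mulr_suml.
  by apply: eq_bigr => q _; rewrite mulrA.
rewrite -(@big_allpairs_dep _ _ _ _ _ _ (fun p q => (p.1, q.1, q.2)) _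
  (fun p => sp p.2) (fun t => f t.1.1 * (g t.1.2 * h t.2))).
rewrite -(@big_allpairs_dep _ _ _ _ _ _ (fun p q => (q.1, q.2, p.2)) _
  (fun p => sp p.1) (fun t => f t.1.1 * (g t.1.2 * h t.2))).
apply/perm_big/uniq_perm.
- apply: allpairs_uniq_dep => [|p _|]; try exact: fset_uniq.
  move=> _ _ /allpairsPdep[p [q [+ + ->]]] /allpairsPdep[p' [q' [+ + ->]]] /=.
  rewrite !spP; case: p p' q q' => [? ?] [? ?] [? ?] [? ?] /=.
  by move=> _ /eqP <- _ /eqP <- [-> -> ->].
- apply: allpairs_uniq_dep => [|p _|]; try exact: fset_uniq.
  move=> _ _ /allpairsPdep[p [q [+ + ->]]] /allpairsPdep[p' [q' [+ + ->]]] /=.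
  rewrite !spP; case: p p' q q' => [? ?] [? ?] [? ?] [? ?] /=.
  by move=> _ /eqP <- _ /eqP <- [-> -> ->].
move=> [[a b] c]; apply/allpairsPdep/allpairsPdep => -[p [q []]];
    rewrite !spP => /eqP pk /eqP qp [-> -> ->].
- exists (p.1 + q.1, q.2), (p.1, q.1).
  by rewrite !spP/= eqxx -addrA qp pk eqxx.
- exists (q.1, q.2 + p.2), (q.2, p.2).
  by rewrite !spP/= eqxx addrA qp pk eqxx.
Qed.

Lemma fps_mulC : commutative fps_mul.
Proof.
move=> f g; apply/fpsP => k; rewrite !mulE.
pose sw (p : mindex I * mindex I) := (p.2, p.1).
transitivity (\sum_(p <- map sw (sp k)) g p.1 * f p.2).
  by rewrite big_map; apply: eq_bigr => p _; rewrite mulrC.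
apply/perm_big/uniq_perm.
- by rewrite map_inj_uniq ?fset_uniq// => -[? ?] [? ?] [-> ->].
- exact: fset_uniq.
move=> p; rewrite spP; apply/mapP/idP => [[q + ->]/=|pk].
  by rewrite spP addrC.
by exists (sw p); rewrite ?spP/= 1?addrC//; case: p {pk}.
Qed.

Lemma fps_mul1 : left_id fps_one fps_mul.
Proof.
move=> f; apply/fpsP => k; rewrite mulE.
have k0 : (0, k) \in sp k by rewrite spP/= add0r.
rewrite (bigD1_seq _ k0) ?fset_uniq//= /fps_one eqxx mul1r.
rewrite big_seq_cond big1 ?addr0// => -[a b] /andP[]; rewrite spP/=.
case: (eqVneq a 0) => [->|_ _ _]; last by rewrite mul0r.
by rewrite add0r => /eqP ->; rewrite eqxx.
Qed.

Lemma fps_mulDl : left_distributive fps_mul +%R.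
Proof.
move=> f g h; apply/fpsP => k; rewrite fpsDE !mulE -big_split.
by apply: eq_bigr => p _; rewrite fpsDE mulrDl.
Qed.

Lemma fps_one_neq0 : fps_one != 0.
Proof.
by apply/eqP => /fpsP/(_ 0)/eqP; rewrite fps0E /fps_one eqxx oner_eq0.
Qed.

HB.instance Definition _ := GRing.Zmodule_isComNzRing.Build (fps I R)
  fps_mulA fps_mulC fps_mul1 fps_mulDl fps_one_neq0.

Lemma fpsME f g k : (f * g) k = \sum_(p \in splittings k) f p.1 * g p.2.
Proof. by []. Qed.

Lemma fps1E k : (1 : fps I R) k = (k == 0)%:R. Proof. by []. Qed.

Definition fps_scale (c : R) f : fps I R := fun k => c * f k.

Lemma fps_scaleA a b f : fps_scale a (fps_scale b f) = fps_scale (a * b) f.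
Proof. by apply/fpsP => k; rewrite /fps_scale mulrA. Qed.

Lemma fps_scale1 : left_id 1 fps_scale.
Proof. by move=> f; apply/fpsP => k; rewrite /fps_scale mul1r. Qed.

Lemma fps_scaleDr : right_distributive fps_scale +%R.
Proof. by move=> a f g; apply/fpsP => k; rewrite /fps_scale !fpsDE mulrDr. Qed.

Lemma fps_scaleDl f : {morph fps_scale^~ f : a b / a + b}.
Proof. by move=> a b; apply/fpsP => k; rewrite /fps_scale fpsDE mulrDl. Qed.

HB.instance Definition _ := GRing.Zmodule_isLmodule.Build R (fps I R)
  fps_scaleA fps_scale1 fps_scaleDr fps_scaleDl.

Lemma fpsZE (c : R) f k : (c *: f) k = c * f k. Proof. by []. Qed.

Lemma fps_scaleAl (c : R) f g : c *: (f * g) = (c *: f) * g.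
Proof.
apply/fpsP => k; rewrite fpsZE [LHS]/= [(f * g) k]mulE [RHS]mulE mulr_sumr.
by apply: eq_bigr => p _; rewrite mulrA.
Qed.

HB.instance Definition _ := GRing.Lmodule_isLalgebra.Build R (fps I R)
  fps_scaleAl.
HB.instance Definition _ := GRing.Lalgebra_isComAlgebra.Build R (fps I R).

Definition fps_unit : {pred fps I R} := [pred f | `[< exists g, g * f = 1 >]].

(* x^-1 is the multiplicative inverse if there is one, and x otherwise. *)
Definition fps_inv f : fps I R :=
  if f \in fps_unit then xget 0 [set g | g * f = 1] else f.

Lemma fps_mulVf : {in fps_unit, left_inverse 1 fps_inv *%R}.
Proof.
move=> f uf; rewrite /fps_inv uf.
by move: uf => /asboolP uf; exact: (@xgetPex _ 0 [set g | g * f = 1] uf).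
Qed.

Lemma fps_unitPl f g : g * f = 1 -> fps_unit f.
Proof. by move=> gf; apply/asboolP; exists g. Qed.

Lemma fps_inv_out : {in [predC fps_unit], fps_inv =1 id}.
Proof. by move=> f; rewrite /fps_inv inE => /negPf ->. Qed.

HB.instance Definition _ := GRing.ComNzRing_hasMulInverse.Build (fps I R)
  fps_mulVf fps_unitPl fps_inv_out.

Definition fps_var (i : I) : fps I R := fun k => (k == munit i)%:R.

End PowerSeries.
Arguments fps_var {I} R i.

(* Infinite sums and products of series, taken coefficientwise: a family is    *)
(* summable when each coefficient vanishes for all but finitely many members,  *)
(* and f converges to the product p when each coefficient of the finite        *)
(* partial products is eventually that of p.                                   *)
Section InfiniteSumsProducts.
Variables (I J : choiceType) (R : comNzRingType).

Definition fps_summable (D : set J) (f : J -> fps I R) : Prop :=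
  forall k : mindex I, finite_set [set j | D j /\ f j k != 0].

Definition fps_sum (D : set J) (f : J -> fps I R) : fps I R :=
  fun k => \sum_(j \in D) f j k.

Definition has_sum (D : set J) (f : J -> fps I R) (s : fps I R) : Prop :=
  fps_summable D f /\ s = fps_sum D f.

Definition has_prod (f : J -> fps I R) (p : fps I R) : Prop :=
  forall k : mindex I, exists S : {fset J}, forall T : {fset J},
    (S `<=` T)%fset -> (\prod_(j <- T) f j) k = p k.

Definition multipliable (f : J -> fps I R) : Prop := exists p, has_prod f p.

Definition fps_prod (f : J -> fps I R) : fps I R := xget 0 (has_prod f).

Lemma has_prod_unique f p q : has_prod f p -> has_prod f q -> p = q.
Proof.
move=> fp fq; apply/fpsP => k; have [S pS] := fp k; have [T qT] := fq k.
by rewrite -(pS (S `|` T)%fset) ?fsubsetUl// (qT (S `|` T)%fset) ?fsubsetUr.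
Qed.

Lemma fps_prodP f : multipliable f -> has_prod f (fps_prod f).
Proof. exact: xgetPex. Qed.

End InfiniteSumsProducts.

Definition mpow (I : choiceType) (B : comNzRingType) (v : I -> B)
    (k : mindex I) : B :=
  \prod_(i <- finsupp k) v i ^+ k i.

(* [z^m] of a series in z (the variable None) and the u_i (the variables       *)
(* Some i), as a series in the u_i.                                            *)
Definition zcoef (I : choiceType) (R : comNzRingType) (m : nat)
    (g : fps (option I) R) : fps I R :=
  fun k => g (munit None *+ m + \sum_(i <- finsupp k) munit (Some i) *+ k i).

Definition Mlt (K : fieldType) (r m : nat) : K :=
  ((1 - fps_var K tt) ^- r) (munit tt *+ m).

Section CycleIndex.

Definition is_intpart (m : nat) (la : seq nat) : bool :=
  [&& sorted geq la, 0%N \notin la & sumn la == m].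

Definition zpart (m : nat) (la : seq nat) : nat :=
  (\prod_(1 <= r < m.+1) (r ^ count_mem r la * (count_mem r la)`!))%N.

(* Only p 1, ..., p m matter; the products over r >= 1 stop at m since the     *)
(* parts of a partition of m are at most m.                                    *)
Definition Zset (K : fieldType) (B : comAlgType K) (m : nat) (p : nat -> B) : B :=
  \sum_(la \in [set la | is_intpart m la])
    (zpart m la)%:R^-1 *: \prod_(1 <= r < m.+1) p r ^+ count_mem r la.

End CycleIndex.

(* A decorated rooted tree with vertex set V is given by its root, its parent  *)
(* map (which fixes the root, by convention) and its decorations.              *)
Section Trees.
Variable A : finType.

Definition dtree (V : finType) := (V * {ffun V -> V} * {ffun V -> A})%type.

Definition troot (V : finType) (t : dtree V) : V := t.1.1.
Definition tparent (V : finType) (t : dtree V) : {ffun V -> V} := t.1.2.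
Definition tdec (V : finType) (t : dtree V) : {ffun V -> A} := t.2.

Definition is_rooted_tree (V : finType) (t : dtree V) : bool :=
  (tparent t (troot t) == troot t) &&
  [forall v, fconnect (tparent t) v (troot t)].

Definition fertility (V : finType) (t : dtree V) (v : V) : nat :=
  #|[set w | (w != troot t) && (tparent t w == v)]%SET|.

Definition tree_iso (V W : finType) (t : dtree V) (s : dtree W) : Prop :=
  exists h : V -> W,
    [/\ bijective h,
        h (troot t) = troot s,
        forall v, h (tparent t v) = tparent s (h v) &
        forall v, tdec s (h v) = tdec t v].

End Trees.

(* The index (a, n) : A * nat stands for the element (a, n - 1) of             *)
(* A x Z_{>= -1}: j is encoded by the fertility n = j + 1.                     *)
Notation IA A := (A * nat)%type.

Section TreeCount.
Variable A : finType.

Definition wt (k : mindex (IA A)) : int :=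
  \sum_(i <- finsupp k) (i.2%:Z - 1) * (k i)%:Z.

Definition profile (V : finType) (t : dtree A V) : mindex (IA A) :=
  [fsfun i in [fset (tdec t v, fertility t v) | v in V]%fset =>
     #|[set v | (tdec t v == i.1) && (fertility t v == i.2)]%SET|].

Lemma profileE (V : finType) (t : dtree A V) a n :
  profile t (a, n) = #|[set v | (tdec t v == a) && (fertility t v == n)]%SET|.
Proof.
rewrite /profile fsfunE; case: ifPn => // /imfsetP ne.
apply/esym/eq_card0 => v; rewrite !inE; apply/negP.
by move=> /andP[/eqP ea /eqP en]; case: ne; exists v; rewrite ?ea ?en.
Qed.

(* A tree with profile k has |k| vertices, so up to isomorphism its vertex set *)
(* is 'I_|k| (tree_on_ordinal).                                                *)
Definition trees (k : mindex (IA A)) : {set dtree A 'I_(msize k)} :=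
  [set t | is_rooted_tree t && (profile t == k)]%SET.

Definition ntrees (k : mindex (IA A)) : nat :=
  #|equivalence_partition (fun s t => `[< tree_iso s t >]) (trees k)|.

Lemma tree_iso_refl (V : finType) (t : dtree A V) : tree_iso t t.
Proof. by exists id; split=> //; exists id. Qed.

Lemma tree_iso_sym (V W : finType) (t : dtree A V) (s : dtree A W) :
  tree_iso t s -> tree_iso s t.
Proof.
move=> [h [[g hK gK] hr hp hd]]; exists g; split.
- by exists h.
- by rewrite -hr hK.
- by move=> v; rewrite -[v in LHS]gK -hp hK.
- by move=> v; rewrite -hd gK.
Qed.

Lemma tree_iso_trans (V W X : finType) (t : dtree A V) (s : dtree A W)
    (x : dtree A X) :
  tree_iso t s -> tree_iso s x -> tree_iso t x.
Proof.
move=> [h [bh hr hp hd]] [g [bg gr gp gd]]; exists (g \o h); split=> /=.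
- exact: bij_comp.
- by rewrite hr gr.
- by move=> v; rewrite hp gp.
- by move=> v; rewrite gd hd.
Qed.

Lemma tree_iso_fertility (V W : finType) (t : dtree A V) (s : dtree A W)
    (h : V -> W) :
  bijective h -> h (troot t) = troot s ->
  (forall v, h (tparent t v) = tparent s (h v)) ->
  forall v, fertility s (h v) = fertility t v.
Proof.
move=> bh hr hp v; have hI := bij_inj bh; have [g hK gK] := bh.
rewrite /fertility -(card_imset _ hI); apply: eq_card => w.
rewrite inE; apply/andP/imsetP => [[wr wv]|[x + ->]].
  by exists (g w); rewrite ?gK// inE -(inj_eq hI) gK hr wr -(inj_eq hI) hp gK.
by rewrite inE -hr -hp !(inj_eq hI) => /andP[].
Qed.

Lemma tree_iso_profile (V W : finType) (t : dtree A V) (s : dtree A W) :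
  tree_iso t s -> profile t = profile s.
Proof.
move=> [h [bh hr hp hd]]; apply/mindexP => -[a n]; rewrite !profileE.
have hI := bij_inj bh; have [g hK gK] := bh.
have hf := tree_iso_fertility bh hr hp.
rewrite -(card_imset _ hI); apply: eq_card => w; apply/imsetP/idP.
  by move=> [x + ->]; rewrite !inE hd hf.
by move=> ws; exists (g w); rewrite ?gK//; move: ws; rewrite !inE -hd -hf gK.
Qed.

Lemma tree_iso_rooted (V W : finType) (t : dtree A V) (s : dtree A W) :
  tree_iso t s -> is_rooted_tree t -> is_rooted_tree s.
Proof.
move=> [h [[g hK gK] hr hp _]] /andP[/eqP tr /forallP tc].
apply/andP; split; first by rewrite -hr -hp tr.
apply/forallP => w; have /iter_findex e := tc (g w).
have hi n v : h (iter n (tparent t) v) = iter n (tparent s) (h v).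
  by elim: n => //= n IHn; rewrite hp IHn.
by rewrite -hr -e hi gK; exact: fconnect_iter.
Qed.

Lemma msize_profile (V : finType) (t : dtree A V) : msize (profile t) = #|V|.
Proof.
pose f v := (tdec t v, fertility t v).
have E i : profile t i = (\sum_(v : V) (f v == i))%N.
  case: i => a n; rewrite profileE -sum1_card big_mkcond; apply: eq_bigr => v _.
  by rewrite inE xpair_eqE; case: (_ && _).
rewrite /msize; under eq_bigr => i _ do rewrite E.
rewrite exchange_big -sum1_card; apply: eq_bigr => v _ /=.
have fv : f v \in finsupp (profile t).
  by rewrite mem_finsupp E (bigD1 v)//= eqxx.
rewrite (bigD1_seq _ fv) ?fset_uniq//= eqxx big1 ?addn0// => i /negPf.
by rewrite eq_sym => ->.
Qed.

Lemma tree_on_ordinal (V : finType) (t : dtree A V) :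
  is_rooted_tree t ->
  exists2 s, s \in trees (profile t) & tree_iso t s.
Proof.
move=> tt; have e : #|V| = msize (profile t) by rewrite msize_profile.
pose h v := cast_ord e (enum_rank v).
pose g w := enum_val (cast_ord (esym e) w).
have hK : cancel h g by move=> v; rewrite /h /g cast_ordK enum_rankK.
have gK : cancel g h by move=> w; rewrite /h /g enum_valK cast_ordKV.
pose s : dtree A 'I_(msize (profile t)) :=
  (h (troot t), [ffun w => h (tparent t (g w))], [ffun w => tdec t (g w)]).
have ts : tree_iso t s.
  exists h; split=> //; first by exists g.
  - by move=> v; rewrite /tparent/= ffunE hK.
  - by move=> v; rewrite /tdec/= ffunE hK.
exists s => //; rewrite inE (tree_iso_rooted ts tt)/=.
by apply/eqP/esym/tree_iso_profile.
Qed.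

End TreeCount.

(* K_{-1} *)
Definition wtN1 (A : finType) := {l : mindex (IA A) | wt l == -1}.

Section GeneratingSeries.
Variables (A : finType) (K : fieldType).

Definition uvar (i : IA A) : fps (IA A) K := fps_var K i.

Definition upow (r : nat) (i : IA A) : fps (IA A) K := uvar i ^+ r.

Definition Fterm (v : IA A -> fps (IA A) K) (l : wtN1 A) : fps (IA A) K :=
  (ntrees (val l))%:R *: mpow v (val l).

Definition Fser (v : IA A -> fps (IA A) K) : fps (IA A) K :=
  fps_sum setT (Fterm v).

Definition Sigma (nu : mindex (wtN1 A)) : mindex (IA A) :=
  \sum_(l <- finsupp nu) val l *+ nu l.

(* The product runs over the support of nu only: Mlt r 0 = 1. *)
Definition Hterm (nu : mindex (wtN1 A)) : fps (IA A) K :=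
  (\prod_(l <- finsupp nu) Mlt K (ntrees (val l)) (nu l)) *:
    mpow uvar (Sigma nu).

Definition Hser (m : nat) : fps (IA A) K :=
  fps_sum [set nu | msize nu = m] Hterm.

(* (1 - z u^l)^{- F_l} in K[[z, u]] *)
Definition Pfactor (l : wtN1 A) : fps (option (IA A)) K :=
  (1 - fps_var K None * mpow (fun i => fps_var K (Some i)) (val l))
    ^- ntrees (val l).

End GeneratingSeries.
Arguments uvar {A} K i.
Arguments upow {A} K r i.
Arguments Hser A K m : clear implicits.
Arguments Hterm A K nu : clear implicits.
Arguments Pfactor A K l : clear implicits.

(* Main.v *)
From HB Require Import structures.
Require Import Defs.
From mathcomp Require Import all_boot all_order all_algebra finmap.
From mathcomp Require Import boolp classical_sets functions cardinality fsbigop.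
From mathcomp Require Import ring.

Set Implicit Arguments.
Unset Strict Implicit.
Unset Printing Implicit Defensive.

Import Order.TTheory GRing.Theory Num.Theory.

Local Open Scope classical_set_scope.
Local Open Scope ring_scope.

(* Writing a tree as its root together with the multiset of its subtrees makes *)
(* the coefficient of u^k in F the number of pairs of a root index (a, j) and  *)
(* a multiset of j + 1 trees whose profiles add up to k minus the unit at      *)
(* (a, j). Isomorphism classes are represented by ordered trees whose          *)
(* children are recursively sorted. Only the finitely many trees with profile  *)
(* below a given multi-index N affect the coefficients below N; if x_1, ...,   *)
(* x_n are their monomials, all three right-hand sides reduce to the complete  *)
(* homogeneous symmetric polynomial h_m(x_1, ..., x_n): it counts multisets,   *)
(* it is the coefficient of z^m in the product of the 1 / (1 - z x_i), which   *)
(* grouped by profile is the product of the (1 - z u^l)^(-F_l), and it         *)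
(* satisfies the same Newton recursion m h_m = sum_r p_r h_(m - r) as the      *)
(* cycle index of SET_m.                                                       *)

(** * Ordered trees *)

(** Isomorphic trees are exactly those with the same code ([tree_iso_code], [code_tree_iso]), and
    every canonical ordered tree is a code ([ocanon_realizable]); so [card_codes] lets F_k count the
    canonical ordered trees of profile k. Cutting such a tree at its root expresses the coefficient
    of F at N through the polynomials h_m of the tree monomials below N ([Fser_root]). By
    [has_sum_root], an identity F = sum of u_(a,j) G_(j+1) follows once G_m agrees with h_m of these
    monomials on all coefficients below N, for every N. The three agreements come from [Hser_trunc]
    and [zcoef_prod_trunc], each combined with [zcoef_classes], and from [Zset_trunc]. *)

Inductive otree (A : Type) := ONode of A & seq (otree A).

(** The induction hypothesis has to reach subtrees nested in a list, hence the conjunction over the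
    list; [otree_ind_mem] restates it by membership once equality is decidable. *)
Lemma otree_seq_ind (A : Type) (P : otree A -> Prop) :
  (forall a s, foldr (fun x Q => P x /\ Q) True s -> P (ONode a s)) ->
  forall x, P x.
Proof.
move=> IH; fix loop 1 => -[a s]; apply: IH.
by elim: s => [//|x s IHs] /=; split; [exact: loop|exact: IHs].
Qed.

Section OTreeCountable.
Variable A : countType.

Fixpoint otree_encode (x : otree A) : GenTree.tree A :=
  let: ONode a s := x in
  GenTree.Node 0 (GenTree.Leaf a :: map otree_encode s).

Fixpoint otree_decode (g : GenTree.tree A) : option (otree A) :=
  if g is GenTree.Node _ (GenTree.Leaf a :: s) then
    Some (ONode a (pmap otree_decode s))
  else None.

Lemma otree_encodeK : pcancel otree_encode otree_decode.
Proof.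
elim/otree_seq_ind => a s IHs /=; congr (Some (ONode a _)).
by elim: s IHs => //= x s IHs [-> /IHs /= ->].
Qed.

HB.instance Definition _ := Countable.copy (otree A) (pcan_type otree_encodeK).

Lemma otree_ind_mem (P : otree A -> Prop) :
  (forall a s, {in s, forall x, P x} -> P (ONode a s)) -> forall x, P x.
Proof.
move=> IH; elim/otree_seq_ind => a s Ps; apply: IH => x.
elim: s Ps => //= y s IHs [Py Ps]; rewrite inE => /predU1P[->//|].
exact: IHs.
Qed.

(** Any total order would serve to sort children; this one compares positions in the enumeration of
    the countable type. *)
Definition ole : rel (otree A) :=
  fun x y => (choice.pickle x <= choice.pickle y)%N.

Lemma ole_total : total ole.
Proof. by move=> x y; exact: leq_total. Qed.

Lemma ole_trans : transitive ole.
Proof. by move=> y x z; exact: leq_trans. Qed.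

Lemma ole_anti : antisymmetric ole.
Proof. by move=> x y; rewrite -eqn_leq => /eqP/(pcan_inj choice.pickleK). Qed.

Fixpoint ocanon (x : otree A) : bool :=
  let: ONode _ s := x in sorted ole s && all ocanon s.

End OTreeCountable.

(** * Codes of rooted trees *)

Section Codes.
Variable A : finType.

Fixpoint oprof (x : otree A) : mindex (IA A) :=
  let: ONode a s := x in munit (a, size s) + foldr +%R 0 (map oprof s).

Lemma oprofE a s :
  oprof (ONode a s) = munit (a, size s) + \sum_(x <- s) oprof x.
Proof. by rewrite /= foldrE big_map. Qed.

Section Tree.
Variables (V : finType) (t : dtree A V).
Implicit Types v w : V.

Definition tchildren v : seq V :=
  enum [set w | (w != troot t) && (tparent t w == v)]%SET.

Lemma mem_tchildren v w :
  (w \in tchildren v) = (w != troot t) && (tparent t w == v).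
Proof. by rewrite mem_enum inE. Qed.

Lemma size_tchildren v : size (tchildren v) = fertility t v.
Proof. by rewrite -cardE. Qed.

(** The recursion equation of codes. It has a single solution on a rooted tree ([coding_unique]), so
    codes are computed below by exhibiting solutions instead of unfolding [tcode]. *)
Definition is_coding (g : V -> otree A) : Prop :=
  forall v, g v = ONode (tdec t v) (sort (@ole A) (map g (tchildren v))).

Definition depth v : nat := findex (tparent t) v (troot t).

Fixpoint tcode_rec (n : nat) v : otree A :=
  ONode (tdec t v) (if n is m.+1 then
    sort (@ole A) (map (tcode_rec m) (tchildren v)) else [::]).

(** The fuel drops by one from a vertex to its children. It is 0 only at depth [#|V| - 1], where no
    child can exist, so the recursion is never cut short. *)
Definition tcode v : otree A := tcode_rec (#|V| - (depth v).+1) v.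

Hypothesis rt : is_rooted_tree t.

Let to_root v : fconnect (tparent t) v (troot t).
Proof. by case/andP: rt => _ /forallP. Qed.

Lemma depthS v : v != troot t -> depth v = (depth (tparent t v)).+1.
Proof. by rewrite eq_sym /depth => /(fconnect_findex (to_root v)). Qed.

Lemma depth_lt v : (depth v < #|V|)%N.
Proof. exact: leq_trans (findex_max (to_root v)) (max_card _). Qed.

Lemma tree_ind_down (P : V -> Prop) :
  P (troot t) -> (forall v, v != troot t -> P (tparent t v) -> P v) ->
  forall v, P v.
Proof.
move=> P0 PS v; move e: (depth v) => n; elim: n v e => [|n IHn] v.
  by move/eqP; rewrite /depth findex_eq0 => /eqP ->.
have [->//|vr] := eqVneq v (troot t).
by rewrite depthS// => -[/IHn]; exact: PS.
Qed.

Lemma tree_ind_up (P : V -> Prop) :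
  (forall v, {in tchildren v, forall w, P w} -> P v) -> forall v, P v.
Proof.
move=> PS v; have [n] := ubnP (#|V| - depth v)%N; elim: n v => // n IHn v le.
apply: PS => w; rewrite mem_tchildren => /andP[wr /eqP wv]; apply: IHn.
by rewrite depthS// wv subnS prednK ?subn_gt0 ?depth_lt.
Qed.

Lemma tcode_coding : is_coding tcode.
Proof.
move=> v; rewrite /tcode; case e: (#|V| - _)%N => [|n] /=.
- suff -> : tchildren v = [::] by [].
  case c: (tchildren v) => [//|w s].
  have : w \in tchildren v by rewrite c mem_head.
  rewrite mem_tchildren => /andP[wr /eqP wv]; move/eqP: e.
  by rewrite subn_eq0 leqNgt -wv -depthS// depth_lt.
- congr (ONode _ (sort _ _)); apply/eq_in_map => w.
  rewrite mem_tchildren => /andP[wr /eqP wv].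
  by rewrite depthS// wv subnS e.
Qed.

Lemma coding_unique g g' : is_coding g -> is_coding g' -> g =1 g'.
Proof.
move=> cg cg'; elim/tree_ind_up => v IHv; rewrite cg cg'.
by congr (ONode _ (sort _ _)); apply/eq_in_map.
Qed.

Lemma coding_canon g v : is_coding g -> ocanon (g v).
Proof.
move=> cg; elim/tree_ind_up: v => v IHv; rewrite cg /=.
rewrite sort_sorted; last exact: ole_total.
rewrite all_sort; apply/allP => x /mapP[w /IHv + ->]; exact.
Qed.

(* Summing the recursion of oprof over all vertices, every oprof (g w) with w  *)
(* not the root appears on both sides and cancels.                             *)
Lemma oprof_coding g : is_coding g -> oprof (g (troot t)) = profile t.
Proof.
move=> cg.
have pE v : oprof (g v) = munit (tdec t v, fertility t v) +
    \sum_(w | (w != troot t) && (tparent t w == v)) oprof (g w).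
  rewrite cg oprofE size_sort size_map size_tchildren; congr (_ + _).
  rewrite (perm_big _ (permEl (perm_sort _ _))) big_map /tchildren big_enum.
  by apply: eq_bigl => w; rewrite inE.
have -> : profile t = \sum_v munit (tdec t v, fertility t v).
  apply/mindexP => -[a n]; rewrite profileE.
  rewrite (big_morph (fun k : mindex (IA A) => k (a, n))
    (fun x y => mindexDE x y _) (mindex0E _)).
  rewrite -sum1_card big_mkcond; apply: eq_bigr => v _; rewrite inE.
  rewrite /munit fsfun_withE mzeroE xpair_eqE [a == _]eq_sym [n == _]eq_sym.
  by case: (_ && _).
apply: (@mindexI _ (\sum_(w | w != troot t) oprof (g w))).
transitivity (\sum_v oprof (g v)).
  by rewrite [RHS](bigD1 (troot t))//= addrC.
rewrite (eq_bigr _ (fun v _ => pE v)) big_split addrC; congr (_ + _).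
by rewrite [RHS](partition_big (tparent t) xpredT).
Qed.

End Tree.
End Codes.

(** Greedy matching: the head of s is paired with an element of s' of equal value, which is then
    removed. It will pair children with equal codes; [w0] is only a default value. *)
Lemma perm_map_matching (V W T : eqType) (g : V -> T) (g' : W -> T)
    (s : seq V) (s' : seq W) (w0 : W) :
  uniq s -> uniq s' -> perm_eq (map g s) (map g' s') ->
  exists f : V -> W,
    {in s, forall v, f v \in s' /\ g' (f v) = g v} /\ {in s &, injective f}.
Proof.
elim: s s' => [|x s IHs] s' /=; first by exists (fun=> w0).
move=> /andP[xs us] us' p.
have : g x \in map g' s' by rewrite -(perm_mem p) mem_head.
case/mapP => y ys' gxy; have ps' := perm_to_rem ys'.
have [] := IHs (rem y s') us (rem_uniq y us').
  by rewrite -(perm_cons (g x)) (permPl p) gxy -map_cons perm_map.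
move=> f [fP fI]; have fs' v : v \in s -> (f v != y) && (f v \in s').
  by move=> /fP[]; rewrite mem_rem_uniq// inE.
exists (fun v => if v == x then y else f v); split.
  move=> v; rewrite inE; case: eqVneq => [->//|_ /= vs].
  by have [_ ->] := fP v vs; have /andP[_ ->] := fs' v vs.
move=> v v'; rewrite !inE; case: eqVneq => [->|_] /=; case: eqVneq => [->|_]//=.
- by move=> _ /fs'/andP[/eqP fy _] /esym.
- by move=> /fs'/andP[/eqP fy _] _ /fy.
- exact: fI.
Qed.

Section CodesIso.
Variable A : finType.
Implicit Types V W : finType.

(** The code of s composed with the isomorphism solves the recursion for t, so it is the code of
    t. *)
Lemma tree_iso_code V W (t : dtree A V) (s : dtree A W) :
  is_rooted_tree t -> tree_iso t s -> tcode t (troot t) = tcode s (troot s).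
Proof.
move=> rt ts; have rs := tree_iso_rooted ts rt.
case: ts => h [bh hr hp hd]; rewrite -hr.
apply: (@coding_unique _ _ t rt (tcode t) (tcode s \o h)).
  exact: tcode_coding.
move=> v /=; rewrite (tcode_coding rs) hd; congr ONode.
apply/(perm_sortP (@ole_total _) (@ole_trans _) (@ole_anti _)).
rewrite map_comp; apply: perm_map; have hI := bij_inj bh.
apply: uniq_perm => [||w]; rewrite ?map_inj_uniq ?enum_uniq//.
have [g hK gK] := bh; rewrite -[w]gK (mem_map hI) !mem_tchildren.
by rewrite -hr -hp !(inj_eq hI).
Qed.

Lemma code_tree_iso V W (t : dtree A V) (s : dtree A W) :
  is_rooted_tree t -> is_rooted_tree s ->
  tcode t (troot t) = tcode s (troot s) -> tree_iso t s.
Proof.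
move=> rt rs ets; pose g := tcode t; pose g' := tcode s.
have gE v : g v = _ := tcode_coding rt v.
have g'E w : g' w = _ := tcode_coding rs w.
(* A matching of the children is chosen for every pair of vertices; when the codes differ, nothing
   is asked of f. *)
have /choice[f fP] (p : V * W) : exists f : V -> W, g p.1 = g' p.2 ->
    {in tchildren t p.1, forall v,
       f v \in tchildren s p.2 /\ g' (f v) = g v} /\
    {in tchildren t p.1 &, injective f}.
  have [e|ne] := eqVneq (g p.1) (g' p.2); last first.
    by exists (fun=> troot s) => /eqP; rewrite (negPf ne).
  have [|f fP] := @perm_map_matching _ _ _ g g' (tchildren t p.1)
    (tchildren s p.2) (troot s) (enum_uniq _) (enum_uniq _).
    apply/(perm_sortP (@ole_total _) (@ole_trans _) (@ole_anti _)).
    by move: e; rewrite gE g'E => -[].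
  by exists f.
(* The isomorphism is defined from the root downwards, matching the children   *)
(* of v and those of h v by their codes.                                       *)
pose H := fix H n v :=
  if n is m.+1 then f (tparent t v, H m (tparent t v)) v else troot s.
pose h v := H (depth t v) v.
have hr : h (troot t) = troot s by rewrite /h /depth findex0.
have hS v : v != troot t -> h v = f (tparent t v, h (tparent t v)) v.
  by move=> vr; rewrite /h (depthS rt vr).
have ch v : v != troot t -> v \in tchildren t (tparent t v).
  by rewrite mem_tchildren eqxx andbT.
have hg v : g v = g' (h v).
  elim/(tree_ind_down rt): v => [|v vr IHv]; first by rewrite hr.
  by rewrite hS//; have [/(_ v (ch v vr))[_ ->]] := fP (_, _) IHv.
have hc v : v != troot t ->
    (h v != troot s) /\ tparent s (h v) = h (tparent t v).
  move=> vr; have [/(_ v (ch v vr))[+ _]] := fP (_, _) (hg (tparent t v)).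
  by rewrite /= -hS// mem_tchildren => /andP[? /eqP].
(* If v and w have the same image, so do their parents; these coincide by induction, and the
   matching is injective on the children of one vertex. *)
have hI : injective h.
  move=> v; elim/(tree_ind_down rt): v => [|v vr IHv] w.
    have [->//|wr] := eqVneq w (troot t).
    by rewrite hr => e; have [] := hc w wr; rewrite -e eqxx.
  have [->|wr e] := eqVneq w (troot t).
    by rewrite hr => e; have [] := hc v vr; rewrite e eqxx.
  have pe : tparent t v = tparent t w.
    by apply: IHv; rewrite -(hc v vr).2 -(hc w wr).2 e.
  have [_ fI] := fP (_, _) (hg (tparent t v)).
  apply: fI; rewrite ?ch//=; first by rewrite pe ch.
  by rewrite -[LHS]hS // -[RHS]/(f (_, _) _) pe -[RHS]hS.
(* The number of vertices is the size of the profile, which the root code determines; so the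
   injection h is bijective. *)
have cVW : #|V| = #|W|.
  rewrite -(msize_profile t) -(msize_profile s).
  rewrite -(oprof_coding (tcode_coding rt)).
  by rewrite -(oprof_coding (tcode_coding rs)) ets.
exists h; split=> //.
- by apply: inj_card_bij => //; rewrite cVW.
- move=> v; have [->|/hc[]//] := eqVneq v (troot t).
  by case/andP: rt => /eqP -> _; case/andP: rs => /eqP + _; rewrite hr.
- by move=> v; have := hg v; rewrite gE g'E => -[].
Qed.

End CodesIso.

(** * Grafting trees onto a new root *)

Section Join.
Variables (A : finType) (a : A) (n : nat) (V : 'I_n -> finType).
Variable t : forall i, dtree A (V i).
Hypothesis rt : forall i, is_rooted_tree (t i).

Let W : finType := option {i : 'I_n & V i}.

Definition join_parent (w : W) : W :=
  if w is Some (existT i v) then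
    if v == troot (t i) then None else Some (Tagged V (tparent (t i) v))
  else None.

Definition join_dec (w : W) : A :=
  if w is Some (existT i v) then tdec (t i) v else a.

Definition join : dtree A W := (None, finfun join_parent, finfun join_dec).

Let parE w : tparent join w = join_parent w. Proof. exact: ffunE. Qed.

Lemma join_rooted : is_rooted_tree join.
Proof.
apply/andP; split; first by rewrite parE.
apply/forallP => -[[i v]|]; last exact: connect0.
elim/(tree_ind_down (rt i)): v => [|v vr IHv].
  by apply: connect1; rewrite /= parE /= eqxx.
apply: connect_trans (connect1 _) IHv.
by rewrite /= parE /= (negPf vr).
Qed.

(** Keeping the old codes on the grafted trees and giving the new root the claimed value solves the
    recursion of [is_coding]. *)
Lemma join_code :
  tcode join None =
  ONode a (sort (@ole A) [seq tcode (t i) (troot (t i)) | i <- enum 'I_n]).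
Proof.
pose g (w : W) := if w is Some (existT i v) then tcode (t i) v else
  ONode a (sort (@ole A) [seq tcode (t i) (troot (t i)) | i <- enum 'I_n]).
apply: (coding_unique join_rooted (tcode_coding join_rooted) (g' := g)).
move=> [[i v]|]; rewrite /tdec/= ffunE /=.
- rewrite (tcode_coding (rt i)); congr ONode.
  apply/(perm_sortP (@ole_total _) (@ole_trans _) (@ole_anti _)).
  rewrite (_ : tcode (t i) = g \o (fun v => Some (Tagged V v)))//.
  rewrite map_comp; apply: perm_map; apply: uniq_perm.
  + rewrite map_inj_uniq ?enum_uniq// => x y /Some_inj/eqP.
    by rewrite eq_Tagged => /eqP.
  + exact: enum_uniq.
  move=> [[j w]|]; rewrite mem_tchildren parE /=; last first.
    by apply/negP => /mapP[].
  apply/mapP/eqP => [[x + /Some_inj e]|].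
    have ij : j = i by have := congr1 tag e.
    subst j; move/eqP: e; rewrite eq_Tagged => /eqP /= ->.
    by rewrite mem_tchildren => /andP[/negPf -> /eqP ->].
  case: eqVneq => // wr /Some_inj e.
  have ij : j = i by have := congr1 tag e.
  subst j; exists w => //; move/eqP: e; rewrite eq_Tagged => /eqP /= <-.
  by rewrite mem_tchildren wr eqxx.
- congr ONode.
  apply/(perm_sortP (@ole_total _) (@ole_trans _) (@ole_anti _)).
  have -> : [seq tcode (t i) (troot (t i)) | i <- enum 'I_n] =
      map g [seq Some (Tagged V (troot (t i))) | i <- enum 'I_n].
    exact: map_comp.
  apply: perm_map; apply: uniq_perm.
  + rewrite map_inj_uniq ?enum_uniq// => x y /Some_inj e.
    by have := congr1 tag e.
  + exact: enum_uniq.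
  move=> [[j w]|]; rewrite mem_tchildren parE /=; last first.
    by apply/negP => /mapP[].
  apply/mapP/eqP => [[i _ /Some_inj e]|].
    have ij : j = i by have := congr1 tag e.
    by subst j; move/eqP: e; rewrite eq_Tagged => /eqP /= ->; rewrite eqxx.
  by case: eqVneq => // -> _; exists j; rewrite ?mem_enum.
Qed.

End Join.

(** Trees realizing the children exist by induction; grafting them realizes x, because sorting its
    already sorted list of children changes nothing. *)
Lemma ocanon_realizable (A : finType) (x : otree A) : ocanon x ->
  exists (V : finType) (t : dtree A V),
    is_rooted_tree t /\ tcode t (troot t) = x.
Proof.
elim/otree_ind_mem: x => a s IHs /= /andP[ss /allP cs].
pose T := {V : finType & dtree A V}.
have /choice[f fP] (i : 'I_(size s)) : exists p : T,
    is_rooted_tree (tagged p) /\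
    tcode (tagged p) (troot (tagged p)) = tnth (in_tuple s) i.
  have xs := mem_tnth i (in_tuple s).
  by have [V [t tP]] := IHs _ xs (cs _ xs); exists (existT _ V t).
have rf i := (fP i).1.
exists _, (join a (fun i => tagged (f i))); split; first exact: join_rooted.
rewrite join_code//; congr ONode; rewrite -[RHS](sorted_sort (@ole_trans A) ss).
congr sort; rewrite [RHS](_ : s = map (tnth (in_tuple s)) (enum 'I_(size s))).
  by apply: eq_map => i; rewrite (fP i).2.
by rewrite -[LHS]/(val (in_tuple s)) -[LHS]map_tnth_enum.
Qed.

(** * Isomorphism classes counted by codes *)

Section CodeCount.
Variable A : finType.

Definition codes (k : mindex (IA A)) : {fset otree A} :=
  [fset tcode t (troot t) | t in trees k]%fset.

Lemma mem_codes k x : (x \in codes k) = ocanon x && (oprof x == k).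
Proof.
apply/imfsetP/andP => [[t]|[/ocanon_realizable[V [t [rt <-]]]]].
  rewrite inE => /andP[rt tk] ->; have tc := tcode_coding rt.
  by rewrite (oprof_coding tc) (coding_canon rt _ tc).
rewrite (oprof_coding (tcode_coding rt)) => /eqP <-.
have [s st ts] := tree_on_ordinal rt; exists s => //; exact: tree_iso_code.
Qed.

(** The isomorphism classes are the fibres of the code map on [trees k], and distinct codes have
    distinct nonempty fibres. *)
Lemma card_codes k : #|` codes k| = ntrees k.
Proof.
pose c t := tcode t (troot (t : dtree A 'I_(msize k))).
pose G (x : otree A) : {set dtree A 'I_(msize k)} :=
  [set t in trees k | x == c t]%SET.
have cE : {in trees k &, forall s t, `[< tree_iso s t >] = (c s == c t)}.
  move=> s t; rewrite !inE => /andP[rs _] /andP[rt _].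
  apply/asboolP/eqP => [/(tree_iso_code rs)//|e].
  exact: code_tree_iso.
have GE t : t \in trees k ->
    [set s in trees k | `[< tree_iso t s >]]%SET = G (c t).
  move=> tk; apply/setP => s.
  rewrite [in RHS]finset.in_set [in LHS]finset.in_set.
  by apply: andb_id2l => sk; rewrite cE.
have <- : #|[set G (val x) | x in [set: codes k]]%SET| = #|` codes k|.
  rewrite card_in_imset ?cardsT ?cardfE// => x y _ _ /setP e.
  have /imfsetP[t /= tk tx] := valP x; apply/val_inj.
  have := e t; rewrite [in RHS]finset.in_set [in LHS]finset.in_set.
  by rewrite [t \in _]tk -[c t]tx eqxx => /esym/eqP.
apply: eq_card => B; apply/imsetP/imsetP => [[x _ ->]|[t tk ->]].
  have /imfsetP[t /= tk ->] := valP x; exists t => //; exact/esym/GE.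
have xk : c t \in codes k by apply/imfsetP; exists t.
by exists [` xk]%fset; rewrite ?inE//; exact: GE.
Qed.

End CodeCount.

(** * Symmetric functions *)

Section CompleteSymmetric.
Variable B : comNzRingType.
Implicit Types (x : B) (s : seq B).

(** The complete homogeneous symmetric polynomial h_m of the entries of s: a monomial of degree m
    either contains the first variable or does not. *)
Fixpoint hsym s : nat -> B :=
  if s is x :: s' then
    fix h m := if m is n.+1 then x * h n + hsym s' m else hsym s' 0%N
  else fun m => (m == 0%N)%:R.

Arguments hsym : simpl never.

Lemma hsym_nil m : hsym [::] m = (m == 0%N)%:R.
Proof. by []. Qed.

Lemma hsymS x s n : hsym (x :: s) n.+1 = x * hsym (x :: s) n + hsym s n.+1.
Proof. by []. Qed.

Lemma hsym0 s : hsym s 0 = 1.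
Proof. by elim: s. Qed.

Definition psum s r : B := \sum_(x <- s) x ^+ r.

(** Induction on the list and on the degree. After x is split off the power sums and off h, the part
    over s alone is the identity for s, and the remaining sums, all multiples of x, are evaluated by
    the identity for x :: s in degree one less. *)
Lemma hsym_newton s m :
  m%:R * hsym s m = \sum_(r < m) psum s r.+1 * hsym s (m - r.+1).
Proof.
elim: s m => [|x s IHs] m.
  rewrite big1 => [|r _]; last by rewrite /psum big_nil mul0r.
  by rewrite hsym_nil; case: m => [|m]; rewrite ?mul0r ?mulr0.
elim: m => [|n IHn]; first by rewrite big_ord0 mul0r.
under eq_bigr => r _ do rewrite {1}/psum big_cons -/(psum s _) mulrDl subSS.
rewrite big_split /= big_ord_recl expr1 subn0.
have -> : \sum_(i < n) x ^+ (bump 0 i).+1 * hsym (x :: s) (n - bump 0 i) =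
    x * \sum_(i < n) x ^+ i.+1 * hsym (x :: s) (n - i.+1).
  rewrite mulr_sumr; apply: eq_bigr => i _.
  by rewrite /bump/= add1n exprS mulrA.
have -> : \sum_(i < n.+1) psum s i.+1 * hsym (x :: s) (n - i) =
    x * \sum_(i < n) psum s i.+1 * hsym (x :: s) (n - i.+1) +
    \sum_(i < n.+1) psum s i.+1 * hsym s (n - i).
  rewrite !big_ord_recr /= subnn !hsym0 addrA; congr (_ + _).
  rewrite mulr_sumr -big_split; apply: eq_bigr => i _ /=.
  by rewrite -(subnSK (ltn_ord i)) hsymS mulrDr mulrCA.
have := IHs n.+1; under [in RHS]eq_bigr => r _ do rewrite subSS.
move=> <-; have e : \sum_(i < n) x ^+ i.+1 * hsym (x :: s) (n - i.+1) =
    n%:R * hsym (x :: s) n -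
    \sum_(i < n) psum s i.+1 * hsym (x :: s) (n - i.+1).
  apply/eqP; rewrite eq_sym subr_eq IHn -big_split; apply/eqP/eq_bigr => r _ /=.
  by rewrite -mulrDl /psum big_cons.
by rewrite e hsymS -natr1; ring.
Qed.

End CompleteSymmetric.
Arguments hsym {B} s : simpl never.

Section Multisets.
Variable T : eqType.
Implicit Types (x : T) (L t : seq T).

(* A multiset over L is represented by the list of its elements in the order   *)
(* of L.                                                                       *)
Fixpoint multisets L : nat -> seq (seq T) :=
  if L is x :: L' then
    fix g m := if m is n.+1 then map (cons x) (g n) ++ multisets L' m
               else multisets L' 0%N
  else fun m => if m is 0 then [:: [::]] else [::].

Arguments multisets : simpl never.

Lemma multisetsS x L n :
  multisets (x :: L) n.+1 =
  map (cons x) (multisets (x :: L) n) ++ multisets L n.+1.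
Proof. by []. Qed.

Lemma multisets0 L : multisets L 0 = [:: [::]].
Proof. by elim: L. Qed.

Lemma multisets_sub L m t : t \in multisets L m -> {subset t <= L}.
Proof.
elim: L m t => [|x L IHL] m t; first by case: m; rewrite ?inE// => /eqP ->.
elim: m t => [|m IHm] t; first by rewrite multisets0 inE => /eqP ->.
rewrite multisetsS mem_cat => /orP[/mapP[t' /IHm s ->] y|/IHL s y /s yL].
  by rewrite inE => /predU1P[->|/s//]; rewrite mem_head.
by rewrite inE yL orbT.
Qed.

Lemma multisets_uniq L m : uniq L -> uniq (multisets L m).
Proof.
elim: L m => [|x L IHL] m; first by case: m.
move=> /= /andP[xL uL]; elim: m => [|m IHm]; first by rewrite multisets0.
rewrite multisetsS cat_uniq map_inj_uniq ?IHm ?IHL//=; last by move=> ? ? [].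
rewrite andbT; apply/hasPn => t /multisets_sub s; apply/mapP => -[t' _ e].
by move: xL; rewrite s// e mem_head.
Qed.

(** Since x precedes all of L, a sorted list over x :: L either starts with x or avoids x
    altogether. This identifies sorted lists of children with multisets. *)
Lemma mem_multisets (r : rel T) L m t :
  transitive r -> antisymmetric r -> sorted r L -> uniq L -> reflexive r ->
  (t \in multisets L m) = [&& size t == m, sorted r t & all (mem L) t].
Proof.
move=> rT rA + + rR.
elim: L m t => [|x L IHL] m t /=.
  by case: m t => [|m] [|y t] _ _; rewrite ?multisets0 //= !andbF.
rewrite (path_sortedE rT) => /andP[xL sL] /andP[nxL uL].
elim: m t => [|m IHm] t; first by rewrite multisets0 inE; case: t.
rewrite multisetsS mem_cat IHL//; case: t => [|y t].
  by rewrite orbF; apply/mapP => -[].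
have -> : (y :: t \in map (cons x) (multisets (x :: L) m)) =
    (y == x) && (t \in multisets (x :: L) m).
  by apply/mapP/andP => [[t' tm [-> ->]]|[/eqP -> tm]]; [rewrite eqxx|exists t].
rewrite IHm /= eqSS !(path_sortedE rT) inE.
have [->|yx] /= := eqVneq y x.
  rewrite (negPf nxL) !andbF orbF; case: (size t == m) => //=.
  have [at_|//] := boolP (all (mem (x :: L)) t); rewrite ?andbF// !andbT.
  rewrite (_ : all (r x) t)//; apply/allP => z /(allP at_).
  by rewrite inE => /predU1P[->//|/(allP xL)].
case: (size t == m) => //=; case yL: (y \in L); rewrite ?andbF//=.
case ryt: (all (r y) t) => //=; congr (_ && _); apply: eq_in_all => z zt /=.
rewrite inE; case: eqVneq => // zx; exfalso; move/eqP: yx; apply.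
by apply: rA; rewrite -{1}zx (allP ryt _ zt) (allP xL).
Qed.

Lemma hsym_multisets (B : comNzRingType) (f : T -> B) L m :
  hsym (map f L) m = \sum_(t <- multisets L m) \prod_(y <- t) f y.
Proof.
elim: L m => [|x L IHL] m.
  by case: m => [|m]; rewrite /= hsym_nil ?big_nil// big_seq1 big_nil.
elim: m => [|m IHm]; first by rewrite multisets0 hsym0 big_seq1 big_nil.
rewrite map_cons hsymS -map_cons IHm multisetsS big_cat big_map /=.
rewrite -IHL; congr (_ + _); rewrite mulr_sumr.
by apply: eq_bigr => t _; rewrite big_cons.
Qed.

End Multisets.
Arguments multisets {T} L : simpl never.

(** * Newton recursion of the cycle index *)

Section CycleIndexRecursion.
Variables (K : fieldType) (B : comAlgType K).
Hypothesis charK : [pchar K] =i pred0.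

Lemma finite_intpart m : finite_set [set la | is_intpart m la].
Proof.
pose g (t : {bseq m of 'I_m.+1}) := map val t.
apply: (@sub_finite_set _ _ (range g)); last exact/finite_image/finite_finset.
move=> la /= /and3P[_ la0 /eqP lam].
have le : all (fun r => r <= m)%N la.
  apply/allP => r; rewrite -lam => /perm_to_rem/perm_sumn ->.
  exact: leq_addr.
have sz : (size (map (@inord m) la) <= m)%N.
  rewrite size_map -[X in (_ <= X)%N]lam.
  elim: la la0 {lam le} => //= r la IHla.
  rewrite inE negb_or eq_sym -lt0n => /andP[r0 /IHla le].
  by rewrite -add1n leq_add.
exists (Bseq sz) => //; rewrite /g /= -map_comp -[RHS]map_id.
by apply/eq_in_map => r /(allP le) rm /=; rewrite inordK.
Qed.

Definition intparts m : seq (seq nat) := fset_set [set la | is_intpart m la].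

Lemma mem_intparts m la : (la \in intparts m) = is_intpart m la.
Proof.
rewrite in_fset_set ?inE; last exact: finite_intpart.
exact/asboolP/idP.
Qed.

(** The bound n on the parts is independent of the sum of la, so that terms for partitions of
    different numbers can be compared ([zterm_widen]). *)
Definition zterm (p : nat -> B) (n : nat) (la : seq nat) : B :=
  (zpart n la)%:R^-1 *: \prod_(1 <= r < n.+1) p r ^+ count_mem r la.

Lemma ZsetE m (p : nat -> B) : Zset m p = \sum_(la <- intparts m) zterm p m la.
Proof. by rewrite /Zset fsbig_finite//; exact: finite_intpart. Qed.

Lemma intpart_le m la r : is_intpart m la -> r \in la -> (0 < r <= m)%N.
Proof.
move=> /and3P[_ la0 /eqP <-] rla; rewrite lt0n.
have -> : r != 0%N by apply: contraNneq la0 => <-.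
by rewrite (perm_sumn (perm_to_rem rla)) leq_addr.
Qed.

Lemma zterm_widen p m n la : is_intpart m la -> (m <= n)%N ->
  zterm p n la = zterm p m la.
Proof.
move=> pla mn; have c0 r : (m < r)%N -> count_mem r la = 0%N.
  move=> mr; apply/count_memPn/negP => /(intpart_le pla)/andP[_].
  by rewrite leqNgt mr.
have split_ (R : Type) (idx : R) (op : Monoid.law idx) (F : nat -> R) :
    (forall r, (m < r)%N -> F r = idx) ->
    \big[op/idx]_(1 <= r < n.+1) F r = \big[op/idx]_(1 <= r < m.+1) F r.
  move=> F1; rewrite (big_cat_nat (n := m.+1))//= [X in op _ X]big_nat.
  by rewrite [X in op _ X]big1 ?Monoid.mulm1// => r /andP[/F1].
rewrite /zterm /zpart; congr ((_%:R)^-1 *: _); apply: split_ => r /c0 -> //.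
Qed.

Lemma zterm_perm p n la mu : perm_eq la mu -> zterm p n la = zterm p n mu.
Proof.
move=> /permP e; rewrite /zterm /zpart.
congr ((_%:R)^-1 *: _); apply: eq_bigr => r _; by rewrite e.
Qed.

(** An additional part r multiplies z by r times the new multiplicity of r, a factor that is
    invertible in characteristic zero. *)
Lemma zterm_cons p n r mu : (0 < r <= n)%N ->
  (r * (count_mem r mu).+1)%:R *: zterm p n (r :: mu) = p r * zterm p n mu.
Proof.
move=> rn; have ri : r \in index_iota 1 n.+1 by rewrite mem_index_iota ltnS.
have zE : zpart n (r :: mu) = (r * (count_mem r mu).+1 * zpart n mu)%N.
  rewrite /zpart !(bigD1_seq r ri) ?iota_uniq//= eqxx add1n.
  rewrite (eq_bigr (fun i => (i ^ count_mem i mu * (count_mem i mu)`!)%N));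
    last first.
    by move=> i /negPf ir; rewrite eq_sym ir.
  by rewrite expnS factS; ring.
rewrite /zterm zE !(bigD1_seq r ri) ?iota_uniq//= eqxx add1n.
rewrite [in LHS](eq_bigr (fun i => p i ^+ count_mem i mu)); last first.
  by move=> i /negPf ir; rewrite eq_sym ir.
rewrite scalerA [(_ * zpart _ _)%:R]natrM invfM mulrA divff ?mul1r; last first.
  rewrite ((pcharf0P K).1 charK) muln_eq0 negb_or /= andbT -lt0n.
  by case/andP: rn.
by rewrite exprS -mulrA scalerAr.
Qed.

Lemma intpart_sum m la : is_intpart m la ->
  m = (\sum_(r < m | r.+1 \in la) r.+1 * count_mem r.+1 la)%N.
Proof.
move=> pla; have /and3P[_ _ /eqP lam] := pla.
rewrite -[LHS]lam sumnE [RHS]big_mkcond /=.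
transitivity (\sum_(x <- la) \sum_(r < m | r.+1 == x) r.+1)%N.
  rewrite [LHS]big_seq [RHS]big_seq; apply: eq_bigr => x.
  move=> /(intpart_le pla); case: x => // x xm.
  by rewrite (big_pred1 (Ordinal xm)).
under eq_bigr => x _ do rewrite big_mkcond.
rewrite exchange_big; apply: eq_bigr => r _ /=; rewrite -big_mkcond.
under eq_bigl => x do rewrite eq_sym.
rewrite big_const_seq iter_addn_0; case: ifPn => // /count_memPn c0.
by rewrite c0 muln0.
Qed.

Let part_cons (r : nat) (mu : seq nat) := sort geq (r :: mu).

(** Removing one copy of the part r + 1 is inverse to inserting one and sorting again. *)
Lemma intparts_cons m r : (r < m)%N ->
  perm_eq [seq la <- intparts m | r.+1 \in la]
          (map (part_cons r.+1) (intparts (m - r.+1))).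
Proof.
have gt : total geq by move=> x y; exact: leq_total.
have gtr : transitive geq by move=> y x z xy yz; exact: leq_trans yz xy.
have ga : antisymmetric geq by move=> x y; rewrite andbC; exact: anti_leq.
move=> rm; apply: uniq_perm.
- exact/filter_uniq/fset_uniq.
- rewrite map_inj_in_uniq ?fset_uniq// => la mu.
  rewrite !mem_intparts => /and3P[sl _ _] /and3P[sm _ _].
  move=> /(perm_sortP gt gtr ga); rewrite perm_cons.
  exact: (sorted_eq gtr ga).
move=> la; rewrite mem_filter mem_intparts; apply/andP/mapP.
- move=> [rla pla]; have /and3P[sl l0 /eqP lm] := pla.
  have pl := perm_to_rem rla; exists (rem r.+1 la); last first.
    apply: (sorted_eq gtr ga) => //; first exact: sort_sorted.
    by rewrite perm_sym perm_sort perm_sym.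
  rewrite mem_intparts; apply/and3P; split.
  + exact: subseq_sorted gtr _ _ (rem_subseq _ _) sl.
  + by apply: contra l0 => /mem_rem.
  + by rewrite -lm (perm_sumn pl)/= addKn.
- move=> [mu + ->]; rewrite mem_intparts => /and3P[sm m0 /eqP mm].
  rewrite mem_sort mem_head; split=> //; apply/and3P; split.
  + exact: sort_sorted.
  + by rewrite mem_sort inE.
  + have /permPl/perm_sumn -> := perm_sort geq (r.+1 :: mu).
    by rewrite /= mm subnKC.
Qed.

(** Distribute the factor m over the distinct parts as the sum of r times the multiplicity of r, and
    exchange sums: for fixed r, removing one part r leaves p_r times a term for m - r. *)
Lemma Zset_newton m (p : nat -> B) :
  m%:R *: Zset m p = \sum_(r < m) p r.+1 * Zset (m - r.+1) p.
Proof.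
rewrite ZsetE scaler_sumr.
transitivity (\sum_(la <- intparts m) \sum_(r < m | r.+1 \in la)
    (r.+1 * count_mem r.+1 la)%:R *: zterm p m la).
  rewrite [LHS]big_seq [RHS]big_seq; apply: eq_bigr => la.
  rewrite mem_intparts => pla.
  by rewrite -scaler_suml -natr_sum -(intpart_sum pla).
under eq_bigr => la _ do rewrite big_mkcond.
rewrite exchange_big; apply: eq_bigr => r _ /=; rewrite -big_mkcond -big_filter.
rewrite (perm_big _ (intparts_cons (ltn_ord r))) big_map ZsetE mulr_sumr.
rewrite [LHS]big_seq [RHS]big_seq; apply: eq_bigr => mu.
rewrite mem_intparts => pm.
have pc := permEl (perm_sort geq (r.+1 :: mu)).
rewrite (zterm_perm _ _ pc) (permP pc) /= eqxx add1n zterm_cons ?ltn_ord//.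
by rewrite (zterm_widen _ pm) ?leq_subr.
Qed.

Lemma Zset0 (p : nat -> B) : Zset 0 p = 1.
Proof.
rewrite ZsetE (perm_big [:: [::]]); last first.
  apply: uniq_perm => [||la]; rewrite ?fset_uniq// mem_intparts inE.
  apply/idP/eqP => [pla|->//]; case: la pla => // x la pla.
  by have /(_ x) := intpart_le pla; rewrite mem_head => /(_ isT); case: x pla.
by rewrite big_seq1 /zterm /zpart !big_geq// invr1 scale1r.
Qed.

End CycleIndexRecursion.

(** * Truncated power series *)

Section MIndexOrder.
Variable I : choiceType.
Implicit Types k l n : mindex I.

(** Divisibility of the monomials u^l and u^k, i.e. the componentwise order ([mdvdP]). *)
Definition mdvd l k : Prop := exists q, l + q = k.

Lemma mdvd_refl k : mdvd k k.
Proof. by exists 0; rewrite addr0. Qed.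

Lemma mdvd_trans l k n : mdvd l k -> mdvd k n -> mdvd l n.
Proof. by move=> [q <-] [q' <-]; exists (q + q'); rewrite addrA. Qed.

Lemma mdvd_addr l k : mdvd l (l + k).
Proof. by exists k. Qed.

Lemma mdvd_addl l k : mdvd k (l + k).
Proof. by exists l; rewrite addrC. Qed.

Lemma mdvdP l k : mdvd l k <-> forall i, (l i <= k i)%N.
Proof.
split=> [[q <-] i|le]; first by rewrite mindexDE leq_addr.
exists [fsfun i in finsupp k => (k i - l i)%N]; apply/mindexP => i.
rewrite mindexDE fsfunE; case: ifPn => [_|]; first by rewrite subnKC.
by rewrite mem_finsupp negbK => /eqP k0; have := le i; rewrite k0; case: (l i).
Qed.

Lemma mindex_sumE (J : Type) (s : seq J) (P : pred J) (F : J -> mindex I) i :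
  (\sum_(j <- s | P j) F j) i = (\sum_(j <- s | P j) F j i)%N.
Proof.
exact: (big_morph (fun k : mindex I => k i) (fun x y => mindexDE x y _)
  (mindex0E _)).
Qed.

Lemma mindexMnE k (m : nat) i : (k *+ m) i = (k i * m)%N.
Proof.
elim: m => [|m IHn]; first by rewrite mulr0n mindex0E muln0.
by rewrite mulrS mindexDE IHn mulnS.
Qed.

Lemma munitE (i j : I) : munit i j = (j == i).
Proof. by rewrite /munit fsfun_withE mzeroE; case: eqP. Qed.

Lemma mdvd_sum (J : eqType) (s : seq J) (F : J -> mindex I) j :
  j \in s -> mdvd (F j) (\sum_(x <- s) F x).
Proof. by move=> js; rewrite (big_rem j)//=; exact: mdvd_addr. Qed.

Lemma mdvd_muln k (m : nat) : (0 < m)%N -> mdvd k (k *+ m).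
Proof. by case: m => // m _; rewrite mulrS; exact: mdvd_addr. Qed.

Lemma mindex_sum_unit k : \sum_(i <- finsupp k) munit i *+ k i = k.
Proof.
apply/mindexP => i; rewrite mindex_sumE.
under eq_bigr => j _ do rewrite mindexMnE munitE.
have [ik|ik] := boolP (i \in finsupp k).
  rewrite (bigD1_seq i)//= eqxx mul1n big1 ?addn0// => j /negPf.
  by rewrite eq_sym => ->.
rewrite (fsfun_dflt ik) big_seq big1// => j jk.
by case: eqP ik => [->|]; rewrite ?jk.
Qed.

Lemma big_finsupp (R : Type) (idx : R) (op : Monoid.com_law idx) k (s : seq I)
    (F : I -> nat -> R) :
  uniq s -> {subset finsupp k <= s} -> (forall i, F i 0%N = idx) ->
  \big[op/idx]_(i <- finsupp k) F i (k i) = \big[op/idx]_(i <- s) F i (k i).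
Proof.
move=> us ks F0; rewrite [RHS](bigID (fun i => i \in finsupp k))/=.
rewrite [X in op _ X]big1 ?Monoid.mulm1; last by move=> i /fsfun_dflt ->.
rewrite -[RHS]big_filter; apply/perm_big/uniq_perm; rewrite ?filter_uniq//.
by move=> i; rewrite mem_filter andb_idr//; exact: ks.
Qed.

Lemma finite_mdvd k : finite_set [set l | mdvd l k].
Proof.
apply: (@sub_finite_set _ _ (fst @` splittings k)).
  by move=> l [q e]; exists (l, q).
exact/finite_image/finite_splittings.
Qed.

End MIndexOrder.

Section Monomials.
Variables (I : choiceType) (R : comNzRingType).
Implicit Types (p q k n : mindex I) (f g : fps I R).

Definition mono p : fps I R := fun k => (k == p)%:R.

Lemma fps_coefM f g k :
  (f * g) k = \sum_(p <- fset_set (splittings k)) f p.1 * g p.2.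
Proof. by rewrite fpsME fsbig_finite//; exact: finite_splittings. Qed.

Lemma mem_splittings k (s : mindex I * mindex I) :
  (s \in fset_set (splittings k)) = (s.1 + s.2 == k).
Proof.
rewrite in_fset_set; last exact: finite_splittings.
by apply/idP/eqP; rewrite inE.
Qed.

Lemma coef_monoM p f k : (mono p * f) (p + k) = f k.
Proof.
have pk : (p, k) \in fset_set (splittings (p + k)) by rewrite mem_splittings.
rewrite fps_coefM (bigD1_seq _ pk) ?fset_uniq//= {1}/mono eqxx mul1r.
rewrite big_seq_cond big1 ?addr0// => -[a b] /=.
rewrite mem_splittings /mono /=.
case: (eqVneq a p) => [->|]; rewrite ?mul0r// => /andP[/eqP/mindexI ->].
by rewrite eqxx.
Qed.

Lemma coef_monoM0 p f k : ~ mdvd p k -> (mono p * f) k = 0.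
Proof.
move=> pk; rewrite fps_coefM big_seq big1// => -[a b].
rewrite mem_splittings /= => /eqP abk; rewrite /mono.
case: eqP => [ap|]; rewrite ?mul0r//.
by case: pk; exists b; rewrite -ap.
Qed.

Lemma mono0 : mono 0 = 1.
Proof. by []. Qed.

Lemma monoM p q : mono p * mono q = mono (p + q).
Proof.
apply/fpsP => k; have [[r <-]|npk] := pselect (mdvd p k).
  by rewrite coef_monoM /mono (inj_eq (@mindexI _ p)).
rewrite coef_monoM0// /mono; case: eqP => // e; case: npk.
by rewrite e; exact: mdvd_addr.
Qed.

Lemma monoX p m : mono p ^+ m = mono (p *+ m).
Proof. by elim: m => // m IHm; rewrite exprS IHm monoM mulrS. Qed.

Lemma mono_sum (J : Type) (s : seq J) (F : J -> mindex I) :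
  mono (\sum_(j <- s) F j) = \prod_(j <- s) mono (F j).
Proof. by elim/big_rec2: _ => // j x y _ <-; rewrite monoM. Qed.

Lemma mpow_mono (J : choiceType) (w : J -> mindex I) (k : mindex J) :
  mpow (fun j => mono (w j)) k = mono (\sum_(j <- finsupp k) w j *+ k j).
Proof. by rewrite mono_sum; apply: eq_bigr => j _; rewrite monoX. Qed.

(** The inverse is the geometric series, with coefficient 1 at the multiples of p and 0
    elsewhere. *)
Lemma mono_unit p : p != 0 -> 1 - mono p \is a GRing.unit.
Proof.
move=> p0; apply/unitrPr.
exists (fun k => (`[< exists m : nat, k = p *+ m >])%:R : R).
set geo := (fun k => _).
rewrite mulrBl mul1r; apply/fpsP => k; rewrite fpsDE fpsNE fps1E.
have [[q <-]|npk] := pselect (mdvd p k).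
  rewrite coef_monoM /geo.
  rewrite (_ : `[< _ >] = `[< exists m : nat, q = p *+ m >]); last first.
    apply/asboolP/asboolP => [[[|n] e]|[n ->]]; last first.
    - by exists n.+1; rewrite mulrS.
    - by exists n; apply: (@mindexI _ p); rewrite e mulrS.
    move/eqP: p0; case; apply/mindexP => i; move/mindexP/(_ i): e.
    rewrite mulr0n mindexDE !mindex0E => /eqP.
    by rewrite addn_eq0 => /andP[/eqP].
  rewrite subrr; case: eqP => // /mindexP e; move/eqP: p0; case.
  apply/mindexP => i; have := e i.
  by rewrite mindexDE !mindex0E => /eqP; rewrite addn_eq0 => /andP[/eqP].
rewrite coef_monoM0// subr0 /geo; congr (_%:R); congr nat_of_bool.
apply/asboolP/eqP => [[[//|n] e]|->]; last by exists 0%N.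
by case: npk; rewrite e mulrS; exact: mdvd_addr.
Qed.

(** Congruence modulo the ideal of series without monomials dividing u^n; modulo it, the infinite
    sums and products become finite. *)
Definition eqtrunc n f g : Prop := forall k, mdvd k n -> f k = g k.

Lemma eqtrunc_sym n f g : eqtrunc n f g -> eqtrunc n g f.
Proof. by move=> e k /e. Qed.

Lemma eqtrunc_trans n f g h : eqtrunc n f g -> eqtrunc n g h -> eqtrunc n f h.
Proof. by move=> e e' k kn; rewrite e ?e'. Qed.

Lemma eqtruncD n f f' g g' :
  eqtrunc n f f' -> eqtrunc n g g' -> eqtrunc n (f + g) (f' + g').
Proof. by move=> e e' k kn; rewrite !fpsDE e ?e'. Qed.

Lemma eqtruncM n f f' g g' :
  eqtrunc n f f' -> eqtrunc n g g' -> eqtrunc n (f * g) (f' * g').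
Proof.
move=> e e' k kn; rewrite !fps_coefM big_seq [RHS]big_seq.
apply: eq_bigr => -[a b]; rewrite mem_splittings => /= /eqP abk.
rewrite e ?e'//; apply: mdvd_trans kn; rewrite -abk.
  exact: mdvd_addl.
exact: mdvd_addr.
Qed.

Lemma eqtrunc_sum n (J : Type) (s : seq J) (F G : J -> fps I R) :
  (forall j, eqtrunc n (F j) (G j)) ->
  eqtrunc n (\sum_(j <- s) F j) (\sum_(j <- s) G j).
Proof. by move=> e; elim/big_rec2: _ => // j x y _; exact: eqtruncD. Qed.

Lemma eqtrunc_prod1 n (J : eqType) (s : seq J) (F : J -> fps I R) :
  {in s, forall j, eqtrunc n (F j) 1} -> eqtrunc n (\prod_(j <- s) F j) 1.
Proof.
move=> e; rewrite big_seq; elim/big_rec: _ => // j x js x1.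
by rewrite -[1]mulr1; apply: eqtruncM => //; exact: e.
Qed.

Lemma eqtruncX1 n f m : eqtrunc n f 1 -> eqtrunc n (f ^+ m) 1.
Proof.
move=> e; elim: m => // m IHm.
by rewrite exprS -[1]mulr1; exact: eqtruncM.
Qed.

Lemma eqtruncV1 n f : f \is a GRing.unit -> eqtrunc n f 1 -> eqtrunc n f^-1 1.
Proof.
move=> uf f1; apply: (@eqtrunc_trans _ _ (f * f^-1)).
  rewrite -[X in eqtrunc n X]mul1r; apply: eqtruncM => //.
  exact: eqtrunc_sym.
by rewrite divrr.
Qed.

Lemma eqtrunc_mono0 n p : ~ mdvd p n -> eqtrunc n (mono p) 0.
Proof.
move=> pn k kn; rewrite /mono; case: eqP => // kp; case: pn.
by rewrite -kp.
Qed.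

End Monomials.
Arguments mono {I} R p.

Lemma geometric_step (B : comUnitRingType) (x g : B) :
  1 - x \is a GRing.unit -> (1 - x)^-1 * g = x * ((1 - x)^-1 * g) + g.
Proof.
move=> u; set h := _^-1 * g.
have <- : (1 - x) * h = g by rewrite mulrA divrr ?mul1r.
by rewrite mulrBl mul1r [RHS]addrC subrK.
Qed.

(** * Coefficients of powers of z *)

Section ZCoefficients.
Variables (I : choiceType) (R : comNzRingType).
Implicit Types (l k : mindex I) (g : fps (option I) R).

(** The exponent of z^m u^k, with [None] standing for z. *)
Definition zidx (m : nat) k : mindex (option I) :=
  munit None *+ m + \sum_(i <- finsupp k) munit (Some i) *+ k i.

Lemma zcoefE m g k : zcoef m g k = g (zidx m k).
Proof. by []. Qed.

Lemma zidx_None m k : zidx m k None = m.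
Proof.
rewrite mindexDE mindexMnE munitE mul1n mindex_sumE big1 ?addn0// => i _.
by rewrite mindexMnE munitE mul0n.
Qed.

Lemma zidx_Some m k i : zidx m k (Some i) = k i.
Proof.
rewrite mindexDE mindexMnE munitE mul0n add0n mindex_sumE.
rewrite -[in RHS](mindex_sum_unit k) mindex_sumE; apply: eq_bigr => j _.
by rewrite !mindexMnE !munitE.
Qed.

Lemma zidxD m n k l : zidx (m + n) (k + l) = zidx m k + zidx n l.
Proof.
apply/mindexP => -[i|]; first by rewrite mindexDE !zidx_Some mindexDE.
by rewrite mindexDE !zidx_None.
Qed.

Lemma zidx_inj m : injective (zidx m).
Proof.
by move=> k l e; apply/mindexP => i; rewrite -(zidx_Some m) e zidx_Some.
Qed.

Lemma zidx_eq0 m k : (zidx m k == 0) = (m == 0%N) && (k == 0).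
Proof.
apply/eqP/andP => [e|[/eqP-> /eqP->]].
  rewrite -[m](zidx_None m k) e mindex0E; split=> //; apply/eqP/mindexP => i.
  by rewrite -(zidx_Some m) e !mindex0E.
by apply/mindexP => -[i|]; rewrite ?zidx_Some ?zidx_None !mindex0E.
Qed.

Definition zmono l : fps (option I) R := mono R (zidx 1 l).

Lemma zmonoE l :
  fps_var R None * mpow (fun i => fps_var R (Some i)) l = zmono l.
Proof.
rewrite (mpow_mono R (fun i => munit (Some i))) [LHS](monoM R).
by rewrite -[munit _]mulr1n.
Qed.

Lemma mdvd_zidx l m k : mdvd (zidx 1 l) (zidx m k) -> mdvd l k.
Proof.
by move=> /mdvdP le; apply/mdvdP => i; have := le (Some i); rewrite !zidx_Some.
Qed.

Lemma zcoef1 m : zcoef m 1 = (m == 0%N)%:R :> fps I R.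
Proof.
apply/fpsP => k; rewrite zcoefE fps1E zidx_eq0.
by case: (m == 0%N) => //=; rewrite fps1E.
Qed.

Lemma zcoefD m f g : zcoef m (f + g) = zcoef m f + zcoef m g.
Proof. by []. Qed.

Lemma zcoef_zmono0 l g : zcoef 0 (zmono l * g) = 0.
Proof.
apply/fpsP => k; rewrite zcoefE coef_monoM0// => /mdvdP/(_ None).
by rewrite !zidx_None.
Qed.

Lemma zcoef_zmonoS l g m : zcoef m.+1 (zmono l * g) = mono R l * zcoef m g.
Proof.
apply/fpsP => k; rewrite zcoefE; have [[q <-]|lk] := pselect (mdvd l k).
  by rewrite -[m.+1]add1n zidxD !coef_monoM.
by rewrite !coef_monoM0// => /mdvd_zidx.
Qed.

Lemma zmono_unit l : 1 - zmono l \is a GRing.unit.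
Proof. by apply: mono_unit; rewrite zidx_eq0. Qed.

Lemma zmono_geom l g :
  (1 - zmono l)^-1 * g = zmono l * ((1 - zmono l)^-1 * g) + g.
Proof.
exact/geometric_step/zmono_unit.
Qed.

Lemma zcoef_geom0 l g : zcoef 0 ((1 - zmono l)^-1 * g) = zcoef 0 g.
Proof. by rewrite zmono_geom zcoefD zcoef_zmono0 add0r. Qed.

Lemma zcoef_geomS l g m : zcoef m.+1 ((1 - zmono l)^-1 * g) =
  mono R l * zcoef m ((1 - zmono l)^-1 * g) + zcoef m.+1 g.
Proof. by rewrite {1}zmono_geom zcoefD zcoef_zmonoS. Qed.

(** The generating function of the h_m: a factor 1 / (1 - z x) acts on coefficients of z by the
    recursion that defines [hsym]. *)
Lemma zcoef_prod_geom (J : Type) (s : seq J) (w : J -> mindex I) m :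
  zcoef m (\prod_(j <- s) (1 - zmono (w j))^-1) =
  hsym [seq mono R (w j) | j <- s] m.
Proof.
elim: s m => [|j s IHs] m; first by rewrite big_nil zcoef1.
rewrite big_cons; elim: m => [|m IHm]; first by rewrite zcoef_geom0 IHs !hsym0.
by rewrite zcoef_geomS IHm IHs.
Qed.

End ZCoefficients.

Section NegativePowers.
Variables (I : choiceType) (K : fieldType).

Lemma Mlt0 m : Mlt K 0 m = (m == 0%N)%:R.
Proof.
rewrite /Mlt expr0 invr1 fps1E; congr (nat_of_bool _)%:R.
apply/eqP/eqP => [/mindexP/(_ tt)|->//].
by rewrite mindexMnE munitE mul1n mindex0E.
Qed.

Let geom r : (1 - fps_var K tt) ^- r.+1 =
  mono K (munit tt) * (1 - fps_var K tt) ^- r.+1 + (1 - fps_var K tt) ^- r.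
Proof.
have u : 1 - fps_var K tt \is a GRing.unit.
  by apply: mono_unit; apply/eqP => /mindexP/(_ tt); rewrite munitE mindex0E.
by rewrite -!exprVn exprS; exact: geometric_step.
Qed.

Lemma MltS0 r : Mlt K r.+1 0 = Mlt K r 0.
Proof.
rewrite /Mlt {1}geom fpsDE coef_monoM0 ?add0r// => /mdvdP/(_ tt).
by rewrite munitE mindexMnE muln0.
Qed.

Lemma MltSS r m : Mlt K r.+1 m.+1 = Mlt K r.+1 m + Mlt K r m.+1.
Proof. by rewrite /Mlt {1}geom fpsDE mulrS coef_monoM. Qed.

Lemma MltE0 r : Mlt K r 0 = 1.
Proof. by elim: r => [|r]; rewrite ?Mlt0// MltS0. Qed.

(** The negative binomial series in z u^l. Peeling off one factor 1 / (1 - z u^l) matches the Pascal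
    rule [MltSS]. *)
Lemma zcoef_negpow (l : mindex I) r m g :
  zcoef m ((1 - zmono K l) ^- r * g) =
  \sum_(j < m.+1) Mlt K r j *: (mono K (l *+ j) * zcoef (m - j) g).
Proof.
elim: r m => [|r IHr] m.
  rewrite expr0 invr1 mul1r big_ord_recl /= Mlt0 scale1r.
  rewrite mulr0n mono0 mul1r subn0.
  by rewrite big1 ?addr0// => j _; rewrite Mlt0 scale0r.
rewrite -exprVn exprS -mulrA exprVn; elim: m => [|m IHm].
  by rewrite zcoef_geom0 IHr !big_ord_recl !big_ord0 MltS0.
rewrite zcoef_geomS IHm IHr [X in _ + X]big_ord_recl [RHS]big_ord_recl MltS0.
rewrite addrCA; congr (_ + _); rewrite mulr_sumr -big_split.
apply: eq_bigr => j _ /=; rewrite /bump add1n MltSS scalerDl subSS.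
by congr (_ + _); rewrite -scalerAr mulrA monoM -mulrS.
Qed.

End NegativePowers.

(** * Families of multiplicities with given total *)

Section FiniteFamilies.
Variable J : choiceType.
Implicit Types (nu : mindex J) (s : seq J).

Fixpoint families s (m : nat) : seq (mindex J) :=
  if s is j :: s' then
    [seq munit j *+ n + nu | n <- iota 0 m.+1, nu <- families s' (m - n)]
  else if m is 0%N then [:: 0] else [::].

Arguments families : simpl never.

Lemma families_cons j s m : families (j :: s) m =
  [seq munit j *+ n + nu | n <- iota 0 m.+1, nu <- families s (m - n)].
Proof. by []. Qed.

Lemma msizeE s nu : uniq s -> {subset finsupp nu <= s} ->
  msize nu = (\sum_(j <- s) nu j)%N.
Proof. by move=> us ss; apply: (big_finsupp _ (F := fun _ n => n)). Qed.

Lemma mem_families s m nu : uniq s ->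
  reflect ({subset finsupp nu <= s} /\ msize nu = m) (nu \in families s m).
Proof.
move=> us; apply: (iffP idP).
- elim: s us m nu => [_|j s IHs /= /andP[js us]] m nu.
    case: m => // /[!inE] /eqP ->; rewrite /msize.
    have -> : finsupp (0 : mindex J) = fset0 by exact: finsupp0.
    by rewrite big_seq_fset0.
  rewrite families_cons => /allpairsPdep[n [nu' []]].
  rewrite mem_iota ltnS => nm.
  move=> /(IHs us)[ss sz] ->.
  have sub : {subset finsupp (munit j *+ n + nu') <= j :: s}.
    move=> i; rewrite mem_finsupp mindexDE mindexMnE munitE inE.
    case: (eqVneq i j) => [//|ij]; rewrite mul0n add0n.
    by rewrite -mem_finsupp => /ss.
  split=> //; rewrite (@msizeE (j :: s)) /= ?js//.
  under eq_bigr => i _ do rewrite mindexDE mindexMnE munitE.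
  rewrite big_split /= -(@msizeE (j :: s)) /= ?js//; last first.
    by move=> i /ss; rewrite inE orbC => ->.
  rewrite sz big_cons eqxx mul1n big_seq big1 ?addn0 ?subnKC//.
  by move=> i si; rewrite (negPf (memPn js i si)).
- elim: s us m nu => [_|j s IHs /= /andP[js us]] m nu [ss sz].
    rewrite -sz (@msizeE [::])// big_nil inE; apply/eqP/mindexP => i.
    by rewrite mindex0E; apply: fsfun_dflt; apply/negP => /ss.
  pose nu' : mindex J := [fsfun nu with j |-> 0%N].
  have nuE : nu = munit j *+ nu j + nu'.
    apply/mindexP => i; rewrite mindexDE mindexMnE munitE fsfun_withE.
    by case: eqVneq => [->|]; rewrite ?addn0 ?mul1n.
  have ss' : {subset finsupp nu' <= s}.
    move=> i; rewrite mem_finsupp fsfun_withE; case: (eqVneq i j) => // ij.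
    by rewrite -mem_finsupp => /ss; rewrite inE (negPf ij).
  have e : m = (nu j + msize nu')%N.
    rewrite -sz (@msizeE (j :: s)) /= ?js// (msizeE us ss') big_cons.
    congr (_ + _)%N; rewrite big_seq [RHS]big_seq; apply: eq_bigr => i si.
    by rewrite fsfun_withE (negPf (memPn js i si)).
  rewrite families_cons; apply/allpairsPdep; exists (nu j), nu'; split=> //.
    by rewrite mem_iota ltnS e leq_addr.
  by apply: IHs => //; rewrite e addKn.
Qed.

Lemma families_uniq s m : uniq s -> uniq (families s m).
Proof.
elim: s m => [|j s IHs] m; first by case: m.
move=> /= /andP[js us]; rewrite families_cons.
apply: allpairs_uniq_dep => [|n _|]; rewrite ?iota_uniq ?IHs//.
have j0 n nu : nu \in families s n -> nu j = 0%N.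
  move=> /(mem_families _ _ us)[ss _]; apply: fsfun_dflt.
  by apply: contra js => /ss.
move=> _ _ /allpairsPdep[n [nu [_ + ->]]] /allpairsPdep[n' [nu' [_ + ->]]] /=.
move=> /j0 nj /j0 nj' e.
have en : n = n'.
  have := congr1 (fun x : mindex J => x j) e.
  by rewrite /= !mindexDE !mindexMnE munitE eqxx nj nj' !mul1n !addn0.
by move: e; rewrite en => /mindexI ->.
Qed.

End FiniteFamilies.
Arguments families {J} s m : simpl never.

Section FamilySum.
Variables (I J : choiceType) (K : fieldType) (w : J -> mindex I) (r : J -> nat).

Definition family_factor j n : fps I K := Mlt K (r j) n *: mono K (w j *+ n).

(** Expand each factor by [zcoef_negpow]: choosing a power of z in every factor, with total degree
    m, is choosing a family nu with |nu| = m. *)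
Lemma sum_families (s : seq J) m : uniq s ->
  \sum_(nu <- families s m) \prod_(j <- s) family_factor j (nu j) =
  zcoef m (\prod_(j <- s) (1 - zmono K (w j)) ^- r j).
Proof.
elim: s m => [|j s IHs] m.
  rewrite big_nil zcoef1; case: m => [|m] _ /=; last by rewrite big_nil.
  by rewrite big_seq1 big_nil.
move=> /= /andP[js us]; rewrite big_cons zcoef_negpow families_cons.
rewrite big_allpairs_dep /=.
rewrite -(big_mkord xpredT (fun i =>
  Mlt K (r j) i *: (mono K (w j *+ i) * zcoef (m - i) _))).
rewrite /index_iota subn0; apply: eq_bigr => n _.
rewrite fps_scaleAl -/(family_factor j n) -IHs// mulr_sumr.
rewrite big_seq [RHS]big_seq; apply: eq_bigr => nu.
move=> /(mem_families _ _ us)[ss _].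
have nj : nu j = 0%N by apply: fsfun_dflt; apply: contra js => /ss.
have nE : (munit j *+ n + nu) j = n.
  by rewrite mindexDE mindexMnE munitE eqxx mul1n nj addn0.
have sE i : i \in s -> (munit j *+ n + nu) i = nu i.
  move=> si.
  by rewrite mindexDE mindexMnE munitE (negPf (memPn js i si)) mul0n.
rewrite big_cons nE.
by apply: congr1; apply: eq_big_seq => i si; rewrite sE.
Qed.

End FamilySum.

(** * The functional equation *)

Section Weights.
Variable A : finType.
Implicit Types k l : mindex (IA A).

Lemma wt_sum (s : seq (IA A)) k : uniq s -> {subset finsupp k <= s} ->
  wt k = \sum_(i <- s) (i.2%:Z - 1) * (k i)%:Z.
Proof.
move=> us ks; rewrite /wt.
rewrite (big_finsupp _ (F := fun i n => (i.2%:Z - 1) * n%:Z) us ks)// => i.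
by rewrite mulr0.
Qed.

Lemma wtD k l : wt (k + l) = wt k + wt l.
Proof.
pose s : seq (IA A) := (finsupp k `|` finsupp l)%fset.
have us : uniq s by exact: fset_uniq.
rewrite !(wt_sum us); last 3 first.
- by move=> i ik; rewrite /s in_fsetU ik orbT.
- by move=> i ik; rewrite /s in_fsetU ik.
- move=> i; rewrite mem_finsupp mindexDE addn_eq0 negb_and -!mem_finsupp.
  by rewrite /s in_fsetU.
rewrite -big_split; apply: eq_bigr => i _ /=.
by rewrite mindexDE PoszD mulrDr.
Qed.

Lemma wt0 : wt (0 : mindex (IA A)) = 0.
Proof. by rewrite /wt big1// => i _; rewrite mindex0E mulr0. Qed.

Lemma wt_munit i : wt (munit i : mindex (IA A)) = i.2%:Z - 1.
Proof.
rewrite (@wt_sum [:: i])//; first by rewrite big_seq1 munitE eqxx mulr1.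
by move=> j; rewrite mem_finsupp munitE inE; case: (j == i).
Qed.

(** A root with n children contributes n - 1, and each child contributes -1 by induction. *)
Lemma wt_oprof (x : otree A) : wt (oprof x) = -1.
Proof.
elim/otree_ind_mem: x => a s IHs; rewrite oprofE wtD wt_munit /=.
rewrite (big_morph (@wt A) wtD wt0) big_seq (eq_bigr _ IHs) -big_seq.
by rewrite big_const_seq count_predT iter_addr_0 mulNrn natz; ring.
Qed.

End Weights.

(** * Reduction of the right-hand sides to complete symmetric polynomials *)

Section Assembly.
Variables (A : finType) (K : fieldType).
Implicit Types (k N : mindex (IA A)).

Lemma finite_mdvd_inj (J I : choiceType) (f : J -> mindex I) (k : mindex I) :
  injective f -> finite_set [set j | mdvd (f j) k].
Proof.
move=> fI; apply: (@finite_preimage _ _ [set l | mdvd l k] f).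
  by move=> x y _ _; exact: fI.
exact: finite_mdvd.
Qed.

Definition classes N : {fset wtN1 A} := fset_set [set l | mdvd (val l) N].

Lemma mem_classes N l : reflect (mdvd (val l) N) (l \in classes N).
Proof.
rewrite in_fset_set; last exact: (@finite_mdvd_inj (wtN1 A) _ val N val_inj).
by apply: (iffP idP); rewrite inE.
Qed.

(** Sorted, so that [mem_multisets] applies to it. *)
Definition trees_upto N : seq (otree A) :=
  sort (@ole A) [seq x | l <- classes N, x <- codes (val l)].

Lemma mem_trees_upto N x :
  reflect (ocanon x /\ mdvd (oprof x) N) (x \in trees_upto N).
Proof.
rewrite mem_sort; apply: (iffP allpairsPdep).
  move=> [l [y [/mem_classes lk + ->]]]; rewrite mem_codes.
  by move=> /andP[-> /eqP ->].
move=> [cx xk]; have wx : wt (oprof x) == -1 by rewrite wt_oprof.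
exists (Sub (oprof x) wx), x; rewrite mem_codes cx eqxx; split=> //.
exact/mem_classes.
Qed.

Lemma trees_upto_uniq N : uniq (trees_upto N).
Proof.
rewrite sort_uniq; apply: allpairs_uniq_dep => [|l _|]; rewrite ?fset_uniq//.
move=> _ _ /allpairsPdep[l [x [_ + ->]]] /allpairsPdep[l' [x' [_ + ->]]] /=.
rewrite !mem_codes => /andP[_ /eqP xl] /andP[_ /eqP xl'] e.
have ll : l = l' by apply: val_inj; rewrite -[LHS]xl -[RHS]xl' e.
by rewrite e ll.
Qed.

Lemma big_trees_upto (R : Type) (idx : R) (op : Monoid.com_law idx) N
    (F : otree A -> R) :
  \big[op/idx]_(x <- trees_upto N) F x =
  \big[op/idx]_(l <- classes N) \big[op/idx]_(x <- codes (val l)) F x.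
Proof. by rewrite (perm_big _ (permEl (perm_sort _ _))) big_allpairs_dep. Qed.

Lemma iter_codes (R : Type) (idx : R) (op : Monoid.com_law idx) l
    (F : mindex (IA A) -> R) :
  \big[op/idx]_(x <- codes l) F (oprof x) = iter (ntrees l) (op (F l)) idx.
Proof.
rewrite (eq_big_seq (fun=> F l)) => [|x].
  by rewrite big_const_seq count_predT -card_codes.
by rewrite mem_codes => /andP[_ /eqP ->].
Qed.

Definition tree_monos N : seq (fps (IA A) K) :=
  [seq mono K (oprof x) | x <- trees_upto N].

Lemma mpow_uvar k : mpow (uvar K) k = mono K k.
Proof. by rewrite [LHS](mpow_mono K (@munit _)) mindex_sum_unit. Qed.

Lemma mpow_upow r k : mpow (upow K r) k = mono K (k *+ r).
Proof.
rewrite (_ : upow K r = fun i => mono K (munit i *+ r)); last first.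
  by apply/funext => i; rewrite -monoX.
rewrite mpow_mono; congr mono; rewrite -[in RHS](mindex_sum_unit k) -sumrMnl.
by apply: eq_bigr => i _; rewrite -!mulrnA mulnC.
Qed.

Lemma FtermE r (l : wtN1 A) : Fterm (upow K r) l =
  (ntrees (val l))%:R *: mono K (val l *+ r).
Proof. by rewrite /Fterm mpow_upow. Qed.

Lemma Fterm_out r N k (l : wtN1 A) : (0 < r)%N -> mdvd k N ->
  l \notin classes N -> Fterm (upow K r) l k = 0.
Proof.
move=> r0 kN /mem_classes lk; rewrite FtermE fpsZE /mono.
case: eqP => [kl|]; rewrite ?mulr0//; case: lk.
apply: mdvd_trans kN; rewrite kl; exact: mdvd_muln.
Qed.

(** Passing to u^[r] raises every tree monomial to the power r. As r > 0, a profile whose r-th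
    multiple lies below N is itself below N. *)
Lemma Fser_trunc r N : (0 < r)%N ->
  eqtrunc N (Fser (upow K r)) (psum (tree_monos N) r).
Proof.
move=> r0 k kN; rewrite /Fser /fps_sum (fsbigTE (classes N)); last first.
  by move=> l; exact: Fterm_out.
rewrite /psum /tree_monos big_map big_trees_upto.
rewrite (big_morph (fun f : fps (IA A) K => f k) (fun f g => fpsDE f g k)
  (fps0E K k)).
apply: eq_bigr => l _; rewrite FtermE.
rewrite (iter_codes _ _ (fun p => mono K p ^+ r)) monoX -Monoid.iteropE.
by rewrite scaler_nat.
Qed.

(** Both sides satisfy the Newton recursion, with power sums that agree below N; characteristic zero
    allows division by m. *)
Lemma Zset_trunc (charK : [pchar K] =i pred0) m N :
  eqtrunc N (Zset m (fun r => Fser (upow K r))) (hsym (tree_monos N) m).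
Proof.
elim/ltn_ind: m => -[|m] IHm; first by rewrite Zset0 hsym0.
have m0 : m.+1%:R != 0 :> K by rewrite ((pcharf0P K).1 charK).
have E (f g : fps (IA A) K) :
    eqtrunc N (m.+1%:R *: f) (m.+1%:R *: g) -> eqtrunc N f g.
  by move=> e k /e; rewrite !fpsZE => /(mulfI m0).
apply: E; rewrite (Zset_newton charK) scaler_nat -mulr_natl hsym_newton.
apply: eqtrunc_sum => r; apply: eqtruncM; first exact: Fser_trunc.
by apply: IHm; rewrite subSS ltnS leq_subr.
Qed.


Lemma fps_scale_prod (I J : choiceType) (R : comNzRingType) (s : seq J)
    (c : J -> R) (f : J -> fps I R) :
  \prod_(j <- s) (c j *: f j) = (\prod_(j <- s) c j) *: \prod_(j <- s) f j.
Proof.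
elim/big_rec3: _ => [|j x y z _ ->]; first by rewrite scale1r.
rewrite -fps_scaleAl [f j * _]mulrC -fps_scaleAl scalerA [x * f j]mulrC.
by [].
Qed.

Let ntreesv (l : wtN1 A) := ntrees (val l).

(** The factor at multiplicity 0 is 1, so the product over the support may run over any larger
    list. *)
Lemma HtermE (s : seq (wtN1 A)) nu : uniq s -> {subset finsupp nu <= s} ->
  Hterm A K nu = \prod_(l <- s) family_factor K val ntreesv l (nu l).
Proof.
move=> us ss; rewrite /Hterm mpow_uvar /Sigma mono_sum -fps_scale_prod.
apply: (big_finsupp _ (F := family_factor K val ntreesv) us ss) => l.
by rewrite /family_factor MltE0 scale1r.
Qed.

Lemma Hterm_supp nu k N : mdvd k N -> Hterm A K nu k != 0 ->
  {subset finsupp nu <= classes N}.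
Proof.
move=> kN; rewrite /Hterm mpow_uvar fpsZE /mono mulf_eq0 negb_or => /andP[_].
case: (eqVneq k (Sigma nu)) => [kE _ l lnu|_]; last by rewrite eqxx.
apply/mem_classes; apply: mdvd_trans kN; rewrite kE.
apply: mdvd_trans (mdvd_sum (fun l => val l *+ nu l) lnu).
by apply: mdvd_muln; rewrite lt0n -mem_finsupp.
Qed.

Lemma Hterm_families m nu k N : mdvd k N -> msize nu = m ->
  Hterm A K nu k != 0 -> nu \in families (classes N) m.
Proof.
move=> kN sz /(Hterm_supp kN) ss.
by apply/mem_families; rewrite ?fset_uniq.
Qed.

Lemma Hterm_summable m : fps_summable [set nu | msize nu = m] (Hterm A K).
Proof.
move=> k; apply: (@sub_finite_set _ _ [set` families (classes k) m]).
  by move=> nu [sz]; exact: (Hterm_families (mdvd_refl k)).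
exact: finite_seq.
Qed.

(** A coefficient below N only sees families supported on [classes N] ([Hterm_supp]); [sum_families]
    evaluates their sum. *)
Lemma Hser_trunc m N : eqtrunc N (Hser A K m)
  (zcoef m (\prod_(l <- classes N) (1 - zmono K (val l)) ^- ntrees (val l))).
Proof.
move=> k kN; rewrite -(sum_families _ _ ntreesv)// ?fset_uniq//.
rewrite (big_morph (fun f : fps (IA A) K => f k) (fun f g => fpsDE f g k)
  (fps0E K k)) /Hser /fps_sum.
rewrite -(fsbig_widen [set` families (classes N) m]).
- rewrite -fsbig_seq ?families_uniq ?fset_uniq//.
  apply: eq_big_seq => nu /(mem_families _ _ (fset_uniq _))[ss _].
  by rewrite (HtermE (fset_uniq _) ss).
- by move=> nu /= /(mem_families _ _ (fset_uniq _))[].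
- move=> nu [/= sz nin]; apply/eqP; apply: contra_notT nin.
  exact: Hterm_families.
Qed.

Lemma PfactorE (l : wtN1 A) :
  Pfactor A K l = (1 - zmono K (val l)) ^- ntrees (val l).
Proof. by rewrite /Pfactor zmonoE. Qed.

Lemma Pfactor_trunc1 (l : wtN1 A) n : ~ mdvd (zidx 1 (val l)) n ->
  eqtrunc n (Pfactor A K l) 1.
Proof.
move=> ln; rewrite PfactorE -exprVn; apply/eqtruncX1/eqtruncV1.
  exact: zmono_unit.
move=> k kn; have z0 : zmono K (val l) k = 0 := eqtrunc_mono0 K ln kn.
by rewrite fpsDE fpsNE z0 subr0.
Qed.

Lemma prod_Pfactor_trunc (S T : {fset wtN1 A}) n : (S `<=` T)%fset ->
  (forall l, l \in T -> l \notin S -> ~ mdvd (zidx 1 (val l)) n) ->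
  eqtrunc n (\prod_(l <- T) Pfactor A K l) (\prod_(l <- S) Pfactor A K l).
Proof.
move=> /fsubsetP ST out; rewrite (big_fsetID _ (mem S)).
rewrite (_ : [fset x in T | mem S x]%fset = S); last first.
  by apply/fsetP => l; rewrite !inE /= andb_idl//; exact: ST.
rewrite -[X in eqtrunc n _ X]mulr1; apply: eqtruncM => //.
apply: eqtrunc_prod1 => l; rewrite !inE /= => /andP[lT lS].
exact/Pfactor_trunc1/out.
Qed.

(** Only finitely many monomials z u^l divide a given monomial, and every other factor is congruent
    to 1 up to it. *)
Lemma Pfactor_multipliable : multipliable (Pfactor A K).
Proof.
pose S (n : mindex (option (IA A))) : {fset wtN1 A} :=
  fset_set [set l | mdvd (zidx 1 (val l)) n].
exists (fun n => (\prod_(l <- S n) Pfactor A K l) n) => n; exists (S n) => T ST.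
apply: (prod_Pfactor_trunc ST) (mdvd_refl n) => l _ lS ln; move/negP: lS; apply.
rewrite in_fset_set ?inE//; apply: finite_mdvd_inj.
by move=> x y /zidx_inj/val_inj.
Qed.

Lemma zcoef_prod_trunc m N : eqtrunc N (zcoef m (fps_prod (Pfactor A K)))
  (zcoef m (\prod_(l <- classes N) Pfactor A K l)).
Proof.
move=> k kN; rewrite !zcoefE.
have [S SE] := fps_prodP Pfactor_multipliable (zidx m k).
(* Enlarging S gives a partial product that still has the limiting coefficient and contains all of
   [classes N]; the extra factors are then discarded. *)
rewrite -(SE (S `|` classes N)%fset) ?fsubsetUl//.
apply: (prod_Pfactor_trunc (fsubsetUr _ _)) (mdvd_refl _) => l _.
by move=> /mem_classes lN /mdvd_zidx lk; apply: lN; exact: mdvd_trans lk kN.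
Qed.

(** The exponent F_l provides one factor 1 / (1 - z u^l) for each tree of profile l. *)
Lemma zcoef_classes m N :
  zcoef m (\prod_(l <- classes N) (1 - zmono K (val l)) ^- ntrees (val l)) =
  hsym (tree_monos N) m.
Proof.
rewrite -zcoef_prod_geom big_trees_upto; congr zcoef; apply: eq_bigr => l _.
by rewrite (iter_codes _ _ (fun p => (1 - zmono K p)^-1)) iter_mulr_1 exprVn.
Qed.

(** A canonical tree of profile N amounts to a root index in the support of N and a multiset of
    canonical trees whose profiles complete it to N. Only trees from [trees_upto N] can occur as
    children. *)
Lemma Fser_root N : Fser (uvar K) N =
  \sum_(i <- finsupp N) (uvar K i * hsym (tree_monos N) i.2) N.
Proof.
have -> : uvar K = upow K 1 by [].
rewrite (Fser_trunc (ltn0Sn 0) (mdvd_refl N)) /psum /tree_monos big_map.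
under eq_bigr => x _ do rewrite expr1.
under [RHS]eq_bigr => i _ do rewrite hsym_multisets mulr_sumr.
have sumE (J : Type) (s : seq J) (F : J -> fps (IA A) K) :
    (\sum_(j <- s) F j) N = \sum_(j <- s) F j N.
  exact: (big_morph (fun f : fps (IA A) K => f N) (fun f g => fpsDE f g N)
    (fps0E K N)).
rewrite sumE; under [RHS]eq_bigr => i _ do rewrite sumE.
pose L := trees_upto N.
have memL m t : (t \in multisets L m) =
    [&& size t == m, sorted (@ole A) t & all (mem L) t].
  apply: (mem_multisets _ _ (@ole_trans A) (@ole_anti A)).
  - exact/sort_sorted/ole_total.
  - exact: trees_upto_uniq.
  - by move=> x; exact: leqnn.
(* Each root index and multiset is assembled into a tree; the multiset has [i.2] elements, so the
   root contributes exactly [munit i]. *)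
transitivity (\sum_(x <- [seq ONode i.1 t | i <- finsupp N,
                                           t <- multisets L i.2])
    mono K (oprof x) N); last first.
  rewrite big_allpairs_dep; apply: eq_bigr => i _; apply: eq_big_seq => t.
  rewrite memL.
  case: i => a n /and3P[/eqP /= <- _ _].
  by rewrite -mono_sum [in RHS]monoM -oprofE.
(* Both sides now count trees of profile N, so it remains to see that the two filtered lists agree
   up to order. *)
have F s : \sum_(x <- s) mono K (oprof x) N = \sum_(x <- s | oprof x == N) 1.
  rewrite [RHS]big_mkcond; apply: eq_bigr => x _.
  by rewrite /mono eq_sym; case: eqP.
rewrite !F -[LHS]big_filter -[RHS]big_filter; apply/perm_big/uniq_perm.
- exact/filter_uniq/trees_upto_uniq.
- apply/filter_uniq/allpairs_uniq_dep => [|i _|]; first exact: fset_uniq.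
    exact/multisets_uniq/trees_upto_uniq.
  move=> _ _ /allpairsPdep[[a n] [t [_ + ->]]]
    /allpairsPdep[[b m] [u [_ + ->]]].
  rewrite !memL => /and3P[/eqP /= <- _ _] /and3P[/eqP /= <- _ _].
  by move=> [-> ->].
move=> [a t]; rewrite !mem_filter; apply: andb_id2l => /eqP tN.
apply/mem_trees_upto/allpairsPdep => [[/= /andP[st /allP ct] _]|].
- exists (a, size t), t; split=> //.
    by rewrite mem_finsupp -tN oprofE mindexDE munitE eqxx.
  rewrite memL eqxx st /=; apply/allP => x xt; apply/mem_trees_upto.
  split; first exact: ct.
  rewrite -tN oprofE; apply: mdvd_trans (mdvd_addl _ _).
  exact: mdvd_sum.
- move=> [i [u [_ um [_ tu]]]].
  move: um; rewrite -tu memL => /and3P[_ su /allP uL].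
  split; last by rewrite tN; exact: mdvd_refl.
  rewrite /= su; apply/allP => x /uL/mem_trees_upto[].
  by [].
Qed.

(** At k, only the finitely many i in the support of k contribute, and G is needed only below k,
    where it may be replaced by [hsym] before applying [Fser_root]. *)
Lemma has_sum_root (G : nat -> fps (IA A) K) :
  (forall N m, eqtrunc N (G m) (hsym (tree_monos N) m)) ->
  has_sum setT (fun i : IA A => uvar K i * G i.2) (Fser (uvar K)).
Proof.
move=> GE; have out k i : i \notin finsupp k -> (uvar K i * G i.2) k = 0.
  move=> ik; apply: (coef_monoM0 (p := munit i)) => /mdvdP/(_ i).
  by rewrite munitE eqxx (fsfun_dflt ik).
split=> [k|].
  apply: (@sub_finite_set _ _ [set` finsupp k]) => [i [_]|]; last first.
    exact: finite_seq.
  by apply: contraNT => /out ->.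
apply/fpsP => k; rewrite Fser_root /fps_sum (fsbigTE (finsupp k)); last first.
  exact: out.
apply: eq_bigr => i _; apply/esym.
have e : eqtrunc k (uvar K i * G i.2) (uvar K i * hsym (tree_monos k) i.2).
  by apply: eqtruncM => //; exact: GE.
exact: e (mdvd_refl k).
Qed.

Lemma Fterm_summable r : (0 < r)%N ->
  fps_summable setT (Fterm (@upow A K r)).
Proof.
move=> r0 k; apply: (@sub_finite_set _ _ [set` classes k]).
  by move=> l [_]; apply: contraNT; move=> /(Fterm_out r0 (mdvd_refl k)) ->.
exact: finite_fset.
Qed.

End Assembly.

(* The first block says that all infinite sums and products involved are       *)
(* well-defined; an index i : IA A is the pair (a, j + 1).                    *)
Theorem proposition4p6 (A : finType) (K : fieldType)
    (charK : [pchar K] =i pred0) :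
  [/\ forall r : nat, (0 < r)%N -> fps_summable setT (Fterm (@upow A K r)),
      forall m : nat, fps_summable [set nu | msize nu = m] (Hterm A K) &
      multipliable (Pfactor A K)] /\
  [/\ has_sum setT
        (fun i : IA A => uvar K i * Hser A K i.2)
        (Fser (uvar K)),
      has_sum setT
        (fun i : IA A => uvar K i * zcoef i.2 (fps_prod (Pfactor A K)))
        (Fser (uvar K)) &
      has_sum setT
        (fun i : IA A =>
           uvar K i * Zset i.2 (fun r => Fser (upow K r)))
        (Fser (uvar K))].
Proof.
split; first split.
- exact: Fterm_summable.
- exact: Hterm_summable.
- exact: Pfactor_multipliable.
split.
- by apply: has_sum_root => N m; rewrite -zcoef_classes; exact: Hser_trunc.
- apply: (has_sum_root (G := fun m => zcoef m (fps_prod (Pfactor A K)))).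
  move=> N m; rewrite -zcoef_classes.
  apply: (eqtrunc_trans (@zcoef_prod_trunc A K m N)).
  by under eq_bigr => l _ do rewrite PfactorE.
- apply: (has_sum_root (G := fun m => Zset m (fun r => Fser (upow K r)))).
  by move=> N m; exact: Zset_trunc.
Qed.
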